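(* Let $G$ be a planar graph such that $G = T\cup C$, where $T$ is a tree with $V(T)=V(G)$, $C$ is a simple cycle whose vertex set is exactly the set of leaves of $T$, and $E(G)=E(T)\cup E(C)$. If $G$ is not isomorphic to $K_4$, then the boxicity of $G$ equals $2$, i.e. $\mathrm{box}(G)=2$.
   Context: Graphs are finite, simple and undirected. A leaf of a tree is a vertex of degree $1$ in the tree. A simple cycle has at least $3$ vertices (so $T$ has at least $3$ leaves). The tree $T$ is allowed to have vertices of degree $2$. A $k$-dimensional box ($k$-box) is a Cartesian product $R_1\times R_2\times\cdots\times R_k$ where each $R_i$ is a (nonempty, possibly degenerate) closed interval $[a,b]$, $a\le b$, on the real line. A graph $G$ is the intersection graph of a collection of $k$-boxes $\{B_v\}_{v\in V(G)}$ if for all distinct $u,v\in V(G)$: $uv\in E(G)$ if and only if $B_u\cap B_v\neq\emptyset$. The boxicity $\mathrm{box}(G)$ is the minimum integer $k\ge 1$ such that $G$ is the intersection graph of a collection of $k$-boxes (the boxicity of a complete graph is taken to be $1$). *)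

(* Defs.v *)
From HB Require Import structures.
From mathcomp Require Import all_boot all_order all_algebra.
From mathcomp Require Import all_classical all_reals all_analysis.
Set Implicit Arguments.
Unset Strict Implicit.
Unset Printing Implicit Defensive.
Import Order.TTheory GRing.Theory Num.Theory.
Import numFieldNormedType.Exports.
Local Open Scope classical_set_scope.
Local Open Scope ring_scope.

Record sgraph (V : finType) := SGraph {
  adj :> rel V;
  adj_sym : symmetric adj;
  adj_irr : irreflexive adj
}.

Lemma complete_sym (V : finType) : symmetric [rel x y : V | x != y].
Proof. by move=> x y; rewrite /= eq_sym. Qed.

Lemma complete_irr (V : finType) : irreflexive [rel x y : V | x != y].
Proof. by move=> x; rewrite /= eqxx. Qed.

Definition complete (V : finType) : sgraph V :=
  SGraph (@complete_sym V) (@complete_irr V).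

Definition isomorphic (V W : finType) (G : sgraph V) (H : sgraph W) : Prop :=
  exists f : V -> W, bijective f /\ forall x y, H (f x) (f y) = G x y.

Definition acyclic (V : finType) (G : sgraph V) : Prop :=
  forall c : seq V, ucycle G c -> (size c <= 2)%N.

Definition is_tree (V : finType) (G : sgraph V) : Prop :=
  [/\ (0 < #|V|)%N, forall x y, connect G x y & acyclic G].

Definition degree (V : finType) (G : sgraph V) (x : V) : nat :=
  #|[pred y | G x y]|.

Definition leaf (V : finType) (G : sgraph V) (x : V) : bool :=
  degree G x == 1%N.

(* A simple cycle is given by its vertices in cyclic order. *)
Definition simple_cycle (V : finType) (c : seq V) : bool :=
  uniq c && (3 <= size c)%N.

(* The guard is needed because [next c x = x] for [x \notin c]. *)
Definition cycle_adj (V : finType) (c : seq V) : rel V :=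
  [rel x y | [&& x \in c, y \in c & (next c x == y) || (next c y == x)]].

Definition is_arc (R : realType) (A : set (R * R)) (a b : R * R) : Prop :=
  exists f : R -> R * R,
    [/\ {within `[0, 1], continuous f}, {in `[0, 1] &, injective f},
        f 0 = a, f 1 = b & A = f @` `[0, 1]].

(* [p] places the vertices and [D u v] is the curve drawn for the edge [uv],
   endpoints included; values of [D] at non-edges are irrelevant. *)
Definition plane_drawing (R : realType) (V : finType) (G : sgraph V)
    (p : V -> R * R) (D : V -> V -> set (R * R)) : Prop :=
  [/\ injective p,
      forall u v, G u v -> is_arc (D u v) (p u) (p v) /\ D v u = D u v,
      forall u v w, G u v -> D u v (p w) -> w = u \/ w = v
    & forall u v x y, G u v -> G x y -> (x, y) \notin [:: (u, v); (v, u)] ->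
        D u v `&` D x y `<=` [set p u; p v]].

Definition planar (R : realType) (V : finType) (G : sgraph V) : Prop :=
  exists (p : V -> R * R) (D : V -> V -> set (R * R)), plane_drawing G p D.

Definition is_box (R : realType) (k : nat) (B : set ('I_k -> R)) : Prop :=
  exists a b : 'I_k -> R,
    (forall i, a i <= b i) /\ B = [set x | forall i, x i \in `[a i, b i]].

Definition box_representable (R : realType) (V : finType) (G : sgraph V)
    (k : nat) : Prop :=
  exists B : V -> set ('I_k -> R),
    (forall v, is_box (B v)) /\
    (forall u v, u != v -> G u v <-> B u `&` B v !=set0).

Lemma box_representable_exists (R : realType) (V : finType) (G : sgraph V) :
  exists k, (1 <= k)%N && `[< box_representable R G k >].
Proof.
exists #|V|.+1; apply/asboolP.
(* Coordinate [i] separates the vertex of rank [i] from its non-neighbours. *)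
pose at_ (i : 'I_#|V|.+1) (v : V) := (i == enum_rank v :> nat).
pose nb (i : 'I_#|V|.+1) (v : V) := [exists w, at_ i w && G w v].
pose a (v : V) (i : 'I_#|V|.+1) : R := (~~ (at_ i v || nb i v))%:R.
pose b (v : V) (i : 'I_#|V|.+1) : R := (~~ at_ i v)%:R.
have at_inj i u w : at_ i u -> at_ i w -> u = w.
  by move=> /eqP iu /eqP iw; apply/enum_rank_inj/val_inj; rewrite /= -iu -iw.
have ab v i : a v i <= b v i.
  by rewrite /a /b ler_nat; case: (at_ i v); case: (nb i v).
exists (fun v => [set x | forall i, x i \in `[a v i, b v i]]); split.
  by move=> v; exists (a v), (b v).
move=> u v uv; split=> [Guv | [x [/= xu xv]]].
  exists (fun i => (~~ (at_ i u || at_ i v))%:R).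
  have nbP i w z : G w z -> at_ i w -> nb i z.
    by move=> Gwz iw; apply/existsP; exists w; rewrite iw.
  have Gvu : G v u by rewrite adj_sym.
  split=> i /=; rewrite in_itv /= /a /b !ler_nat.
    have := @nbP i v u Gvu.
    by case: (at_ i u); case: (at_ i v); case: (nb i u) => //= /(_ isT).
  have := @nbP i u v Guv.
  by case: (at_ i u); case: (at_ i v); case: (nb i v) => //= /(_ isT).
apply: contraT => nGuv.
pose i : 'I_#|V|.+1 := widen_ord (leqnSn _) (enum_rank u).
have iu : at_ i u by exact: eqxx.
have iv : at_ i v = false.
  by apply/negP => /(at_inj _ _ _ iu) e; rewrite e eqxx in uv.
have nv : nb i v = false.
  apply/existsP => -[w /andP[iw Gwv]].
  by rewrite -(at_inj _ _ _ iu iw) (negbTE nGuv) in Gwv.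
have := xu i; have := xv i.
rewrite !in_itv /= /a /b iu iv nv /= => /andP[x1 _] /andP[_ x0].
by have := le_trans x1 x0; rewrite ler10.
Qed.

Definition boxicity (R : realType) (V : finType) (G : sgraph V) : nat :=
  ex_minn (box_representable_exists R G).

(* Main.v *)
Require Import Defs.
From HB Require Import structures.
From mathcomp Require Import all_boot all_order all_algebra.
From mathcomp Require Import all_classical all_reals all_analysis.
From mathcomp Require Import zify ring lra.

Set Implicit Arguments.
Unset Strict Implicit.
Unset Printing Implicit Defensive.
Import Order.TTheory GRing.Theory Num.Theory.
Import numFieldNormedType.Exports.

(* Topology: replacing arcs by fine polygons, the parity of the crossings of an
   edge with a horizontal ray issued from a vertex is defined, and for two disjoint
   edges four such parities satisfy a linear relation over F_2, because the
   difference of the two arcs never vanishes on a square. Along a subdivision of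
   K_{3,3} these relations add up to 0 = 1.

   Upper bound: root T at the first leaf of C and index the leaves along C. If two
   incomparable vertices had interleaved sets of leaf indices below them, T and C
   would contain a subdivision of K_{3,3}; hence the ranges of indices below two
   vertices are nested or disjoint, and T can be drawn with boxes as an icicle
   diagram (leaf index against depth), which is then adjusted to realize C.

   Lower bound: the interval with the smallest right end gives a simplicial vertex.
   But C is an induced cycle if it has at least 4 vertices, and G itself has no
   simplicial vertex if C is a triangle and G is not K_4. *)

(** * Parities of crossings and K_{3,3} *)

(** Edges are drawn as arbitrary continuous arcs, so neither faces nor the Jordan curve theorem are
    at hand. The parities replace both: they only use that two edges without a common end are
    disjoint, and the arcs of edges with a common end are never compared. Planarity enters the upper
    bound at a single point, the separation of the leaves below incomparable vertices.

    Rooting at a leaf cuts C open: the root has index 0 and the other leaves are linearly ordered by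
    their index. The price is paid at the two edges of C that meet the root. The first and the last
    leaf must reach both the deep end of the diagram, where consecutive leaves touch, and the box of
    the root, without touching their other ancestors. Hence the chains leading to them are bent out
    of the diagram. If C is a triangle, these two leaves are moreover adjacent to each other, which
    forces a separate layout. The graph K_4 is excluded because a complete graph has boxicity 1. *)

Definition conn_in (V : finType) (G : rel V) (S : V -> Prop) (x y : V) : Prop :=
  exists p : seq V, [/\ path G x p, last x p = y & forall z, z \in x :: p -> S z].

Lemma conn_in_refl (V : finType) (G : rel V) (S : V -> Prop) x : S x -> conn_in G S x x.
Proof. by move=> Sx; exists [::]; split=> // z; rewrite inE => /eqP ->. Qed.

Lemma conn_in_step (V : finType) (G : rel V) (S : V -> Prop) x y z :
  S x -> G x y -> conn_in G S y z -> conn_in G S x z.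
Proof.
move=> Sx xy [p [py lp Sp]]; exists (y :: p); split=> //=; first by rewrite xy.
by move=> w; rewrite inE => /orP[/eqP ->|/Sp].
Qed.

(* [o u v] is 1 when [u] lies after [v] in some total order, and [m v x y] is the
   crossing parity of a ray issued from [v] with the edge [xy]. *)
Section Parity.
Variables (V : finType) (G : rel V) (m : V -> V -> V -> nat) (o : V -> V -> nat).
Hypothesis o_anti : forall u v, u != v -> o u v + o v u = 1.
Hypothesis m_rel : forall a b c d, G a b -> G c d ->
  a != c -> a != d -> b != c -> b != d ->
  exists k, m c a b + m d a b + m a c d + m b c d
            + (o a c + o a d + o b c + o b d) = 2 * k.

Fixpoint mpath (v x : V) (p : seq V) : nat :=
  if p is y :: q then m v x y + mpath v y q else 0.

(** When the relation for the first edge [ab] is added to that for the rest of the path, the terms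
    of the shared vertex [b] occur twice; the witness subtracts them once. *)
Lemma mpath_edge a p c d : path G a p -> G c d -> c \notin a :: p -> d \notin a :: p ->
  exists k, mpath c a p + mpath d a p + m a c d + m (last a p) c d
            + (o a c + o a d + o (last a p) c + o (last a p) d) = 2 * k.
Proof.
elim: p a => [|b p IH] a /=; first by move=> _ _ _ _; exists (m a c d + (o a c + o a d)); lia.
case/andP=> ab bp cd; rewrite !inE !negb_or => /and3P[ca cb cp] /and3P[da db dp].
have := IH b bp cd; rewrite !inE !negb_or cb cp db dp => /(_ isT isT)[k1 e1].
have [] := m_rel ab cd; rewrite 1?[_ == c]eq_sym 1?[_ == d]eq_sym // => k2 e2.
exists (k1 + k2 - (m b c d + o b c + o b d)); lia.
Qed.

Lemma mpath_path a p c q : path G a p -> path G c q ->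
  (forall z, z \in a :: p -> z \in c :: q -> False) ->
  exists k, mpath c a p + mpath (last c q) a p + mpath a c q + mpath (last a p) c q
    + (o a c + o a (last c q) + o (last a p) c + o (last a p) (last c q)) = 2 * k.
Proof.
move=> ap; elim: q c => [|d q IH] c /=.
  by move=> _ _; exists (mpath c a p + (o a c + o (last a p) c)); lia.
case/andP=> cd dq dis.
have [|k1 e1] := IH d dq; first by move=> z zp zq; apply: (dis z zp); rewrite inE zq orbT.
have [||k2 e2] := mpath_edge ap cd.
- by apply/negP => /dis; apply; rewrite inE eqxx.
- by apply/negP => /dis; apply; rewrite !inE eqxx orbT.
exists (k1 + k2 - (mpath d a p + o a d + o (last a p) d)); lia.
Qed.

(** Only paths with no common end have to be disjoint. Two paths with a common end may overlap,
    since no relation compares them, so this is more flexible than a subdivision in the strict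
    sense. *)
Lemma no_K33 (A B : 'I_3 -> V) (S : 'I_3 -> 'I_3 -> V -> Prop) :
  (forall i j, conn_in G (S i j) (A i) (B j)) ->
  (forall i j k l z, i != k -> j != l -> S i j z -> S k l z -> False) -> False.
Proof.
move=> conn dis.
have [p pP] := choice (fun ij : 'I_3 * 'I_3 => conn ij.1 ij.2).
have rel i j k l : i != k -> j != l -> exists K,
    mpath (A k) (A i) (p (i, j)) + mpath (B l) (A i) (p (i, j))
    + mpath (A i) (A k) (p (k, l)) + mpath (B j) (A k) (p (k, l))
    + (o (A i) (A k) + o (A i) (B l) + o (B j) (A k) + o (B j) (B l)) = 2 * K.
  move=> ik jl; have [/= pij lij Sij] := pP (i, j); have [/= pkl lkl Skl] := pP (k, l).
  have := mpath_path pij pkl; rewrite lij lkl; apply=> z zp zq.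
  exact: dis ik jl (Sij _ zp) (Skl _ zq).
have AS i j : S i j (A i) by have [_ _ ] := pP (i, j); apply; rewrite mem_head.
have BS i j : S i j (B j).
  by have [_ <- ] := pP (i, j); apply; rewrite mem_last.
have other (i : 'I_3) : exists k, i != k.
  by exists (i + 1)%R; case: i => -[|[|[]]].
have dAB i j : o (A i) (B j) + o (B j) (A i) = 1.
  have [[k ik] [l jl]] := (other i, other j).
  apply: o_anti; apply/eqP => e; apply: (dis i l k j (A i)) => //; first by rewrite eq_sym.
  by rewrite e.
have dAA i k : i != k -> o (A i) (A k) + o (A k) (A i) = 1.
  move=> ik; apply: o_anti; apply/eqP => e; apply: (dis i 0%R k 1%R (A i)) => //.
  by rewrite e.
have dBB j l : j != l -> o (B j) (B l) + o (B l) (B j) = 1.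
  move=> jl; apply: o_anti; apply/eqP => e; apply: (dis 0%R j 1%R l (B j)) => //.
  by rewrite e.
pose i0 : 'I_3 := 0%R; pose i1 : 'I_3 := 1%R; pose i2 : 'I_3 := 2%R.
have [K0011 e0011] := @rel i0 i0 i1 i1 isT isT.
have [K0012 e0012] := @rel i0 i0 i1 i2 isT isT.
have [K0110 e0110] := @rel i0 i1 i1 i0 isT isT.
have [K0112 e0112] := @rel i0 i1 i1 i2 isT isT.
have [K0210 e0210] := @rel i0 i2 i1 i0 isT isT.
have [K0211 e0211] := @rel i0 i2 i1 i1 isT isT.
have [K0021 e0021] := @rel i0 i0 i2 i1 isT isT.
have [K0022 e0022] := @rel i0 i0 i2 i2 isT isT.
have [K0120 e0120] := @rel i0 i1 i2 i0 isT isT.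
have [K0122 e0122] := @rel i0 i1 i2 i2 isT isT.
have [K0220 e0220] := @rel i0 i2 i2 i0 isT isT.
have [K0221 e0221] := @rel i0 i2 i2 i1 isT isT.
have [K1021 e1021] := @rel i1 i0 i2 i1 isT isT.
have [K1022 e1022] := @rel i1 i0 i2 i2 isT isT.
have [K1120 e1120] := @rel i1 i1 i2 i0 isT isT.
have [K1122 e1122] := @rel i1 i1 i2 i2 isT isT.
have [K1220 e1220] := @rel i1 i2 i2 i0 isT isT.
have [K1221 e1221] := @rel i1 i2 i2 i1 isT isT.
have ab00 := dAB i0 i0.
have ab01 := dAB i0 i1.
have ab02 := dAB i0 i2.
have ab10 := dAB i1 i0.
have ab11 := dAB i1 i1.
have ab12 := dAB i1 i2.
have ab20 := dAB i2 i0.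
have ab21 := dAB i2 i1.
have ab22 := dAB i2 i2.
have aa01 := @dAA i0 i1 isT.
have bb01 := @dBB i0 i1 isT.
have aa02 := @dAA i0 i2 isT.
have bb02 := @dBB i0 i2 isT.
have aa12 := @dAA i1 i2 isT.
have bb12 := @dBB i1 i2 isT.
(* Every [mpath v P] occurs in exactly two of the 18 relations, and each pair
   of vertices in an even number of them, whereas the comparisons, once oriented
   by [o_anti], leave an odd constant. *)
clear -e0011 e0012 e0110 e0112 e0210 e0211 e0021 e0022 e0120 e0122 e0220 e0221 e1021 e1022 e1120 e1122 e1220 e1221 ab00 ab01 ab02 ab10 ab11 ab12 ab20 ab21 ab22 aa01 aa02 aa12 bb01 bb02 bb12.
lia.
Qed.
End Parity.

(** * Crossings of a segment with a ray *)

Section Crossing.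
Local Open Scope ring_scope.
Variable R : realFieldType.
Implicit Types p q r u : R * R.

(** The upper side of the first axis turned infinitesimally clockwise: of [p] and [- p], if nonzero,
    exactly one is on it. No general position is needed afterwards. *)
Definition lexpos p : bool := (0 < p.2) || ((p.2 == 0) && (0 < p.1)).
Definition det2 p q : R := p.1 * q.2 - p.2 * q.1.
Definition dot2 p q : R := p.1 * q.1 + p.2 * q.2.

(* For a segment [p, q] avoiding the origin: it crosses the positive half of the
   first axis, points of that axis being attributed to a side by [lexpos]. *)
Definition cross p q : bool :=
  (lexpos p != lexpos q) && (lexpos q == (0 < det2 p q)).

Lemma lexposN p : p != 0 -> lexpos (- p) = ~~ lexpos p.
Proof.
case: p => x y; rewrite /lexpos /= -[0]/(0, 0) xpair_eqE !oppr_gt0 oppr_eq0 negb_or negb_and -!leNgt.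
by case: (ltgtP y 0) => //= _; case: (ltgtP x 0).
Qed.

(** Negation exchanges the two halves of the axis. A segment whose ends have different [lexpos]
    crosses exactly one of the halves, and any other segment crosses neither. *)
Lemma crossN p q : p != 0 -> q != 0 ->
  cross (- p) (- q) = cross p q (+) (lexpos p (+) lexpos q).
Proof.
move=> p0 q0; have -> : cross (- p) (- q) =
    (lexpos (- p) != lexpos (- q)) && (lexpos (- q) == (0 < det2 p q)).
  by rewrite /cross; congr (_ && (_ == (0 < _))); rewrite /det2 /=; ring.
rewrite !lexposN // /cross.
by case: (lexpos p); case: (lexpos q); case: (0 < _).
Qed.

Lemma dot2_neq0 u p : 0 < dot2 u p -> p != 0.
Proof. by apply: contraTneq => ->; rewrite /dot2 /= !mulr0 addr0 ltxx. Qed.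

(** Both sides cut out by [lexpos] are convex cones; [r != 0] excludes the trivial combination. *)
Lemma lexpos_comb a b c p q r : 0 < a -> 0 <= b -> 0 <= c ->
  p != 0 -> q != 0 -> r != 0 ->
  a * r.1 = b * p.1 + c * q.1 -> a * r.2 = b * p.2 + c * q.2 ->
  lexpos p = lexpos q -> lexpos r = lexpos p.
Proof.
have pos p' q' r' : 0 < a -> 0 <= b -> 0 <= c -> r' != 0 ->
    a * r'.1 = b * p'.1 + c * q'.1 -> a * r'.2 = b * p'.2 + c * q'.2 ->
    lexpos p' -> lexpos q' -> lexpos r'.
  case: p' q' r' => [p1 p2] [q1 q2] [r1 r2] a0 b0 c0; rewrite /lexpos /=.
  rewrite -[0]/(0, 0) xpair_eqE negb_and => r0 e1 e2 hp hq.
  have p2_ge0 : 0 <= p2 by case/orP: hp => [/ltW //|/andP[/eqP -> _]].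
  have q2_ge0 : 0 <= q2 by case/orP: hq => [/ltW //|/andP[/eqP -> _]].
  have ar2 : 0 <= a * r2 by rewrite e2 addr_ge0 ?mulr_ge0.
  rewrite pmulr_rge0 // in ar2; move: ar2; rewrite le_eqVlt => /orP[/eqP r2_0|-> //].
  rewrite -r2_0 ltxx eqxx /=.
  move: e2; rewrite -r2_0 mulr0 => /esym/eqP; rewrite paddr_eq0 ?mulr_ge0 // => /andP[].
  have x_ge0 d (x y : R) : 0 <= d -> d * x == 0 -> (0 < x) || ((x == 0) && (0 < y)) -> 0 <= d * y.
    move=> d0; rewrite mulf_eq0 => /orP[/eqP -> _|/eqP ->]; first by rewrite mul0r.
    by rewrite ltxx eqxx /= => y0; rewrite mulr_ge0 // ltW.
  move=> bp cq; have : 0 <= a * r1 by rewrite e1 addr_ge0 // ?(x_ge0 b p2) ?(x_ge0 c q2).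
  rewrite pmulr_rge0 // le_eqVlt => /orP[/eqP r1_0|//].
  by move: r0; rewrite -r1_0 -r2_0 eqxx.
move=> a0 b0 c0 p0 q0 r0 e1 e2 pq; case hp: (lexpos p); last first.
  apply: negbTE; rewrite -lexposN //; apply: (pos (- p) (- q)) => //=.
  - by rewrite oppr_eq0.
  - by rewrite !mulrN e1 opprD.
  - by rewrite !mulrN e2 opprD.
  - by rewrite lexposN // hp.
  - by rewrite lexposN // -pq hp.
by apply: (pos p q) => //; rewrite -pq.
Qed.

(** A triangle inside an open half-plane bounded by a line through the origin does not surround the
    origin, so a ray from the origin crosses its boundary evenly. *)
Lemma cross_triangle u p q r : 0 < dot2 u p -> 0 < dot2 u q -> 0 < dot2 u r ->
  cross p q (+) cross q r (+) cross p r = false.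
Proof.
move=> up uq ur.
set A := det2 p q; set B := det2 q r; set C := det2 p r.
(* The linear relation [B p - C q + A r = 0]: if the three crossings did not
   cancel, one point would be a nonnegative combination of two points on the
   other side of the axis. *)
have e1 : B * p.1 - C * q.1 + A * r.1 = 0 by rewrite /A /B /C /det2; ring.
have e2 : B * p.2 - C * q.2 + A * r.2 = 0 by rewrite /A /B /C /det2; ring.
have e3 : B * dot2 u p - C * dot2 u q + A * dot2 u r = 0.
  by rewrite /A /B /C /det2 /dot2; ring.
have signs (a b c x y z : R) : 0 < x -> 0 < y -> 0 < z -> a * z = b * x + c * y ->
    0 <= b -> 0 <= c -> 0 < b + c -> 0 < a.
  move=> x0 y0 z0 e b0 c0 bc; rewrite -(pmulr_lgt0 _ z0) e.
  move: b0; rewrite le_eqVlt => /orP[/eqP b0|b0].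
    by rewrite -b0 mul0r add0r mulr_gt0 //; lra.
  by rewrite ltr_pwDl ?mulr_gt0 // mulr_ge0 // ltW.
have -> : cross p q = (lexpos p != lexpos q) && (lexpos q == (0 < A)) by [].
have -> : cross q r = (lexpos q != lexpos r) && (lexpos r == (0 < B)) by [].
have -> : cross p r = (lexpos p != lexpos r) && (lexpos r == (0 < C)) by [].
have comb a b c p' q' r' : 0 < dot2 u p' -> 0 < dot2 u q' -> 0 < dot2 u r' ->
    a * r'.1 = b * p'.1 + c * q'.1 -> a * r'.2 = b * p'.2 + c * q'.2 ->
    0 <= b -> 0 <= c -> 0 < b + c -> lexpos p' = lexpos q' -> lexpos r' = lexpos p'.
  move=> up' uq' ur' f1 f2 b0 c0 bc.
  have a0 : 0 < a.
    apply: (signs _ _ _ _ _ _ up' uq' ur') b0 c0 bc.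
    have -> : a * dot2 u r' = u.1 * (a * r'.1) + u.2 * (a * r'.2) by rewrite /dot2; ring.
    by rewrite f1 f2 /dot2; ring.
  by apply: (lexpos_comb a0 b0 c0 _ _ _ f1 f2); [exact: dot2_neq0 up'|exact: dot2_neq0 uq'|exact: dot2_neq0 ur'].
have comb_neq : forall x y z p' q' r', 0 < dot2 u p' -> 0 < dot2 u q' -> 0 < dot2 u r' ->
    x * r'.1 = y * p'.1 + z * q'.1 -> x * r'.2 = y * p'.2 + z * q'.2 ->
    0 <= y -> 0 <= z -> 0 < y + z -> lexpos p' = lexpos q' -> lexpos r' != lexpos p' -> False.
  by move=> x y z p' q' r' ? ? ? ? ? ? ? ? ? /negP; apply; apply/eqP; apply: (@comb x y z p' q').
have [pq|pq] := eqVneq (lexpos p) (lexpos q); have [qr|qr] := eqVneq (lexpos q) (lexpos r).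
- by rewrite pq qr eqxx.
- have -> : (0 < C) = (0 < B); last by rewrite pq qr /= addbb.
  case: (ltP 0 C) => hC; case: (ltP 0 B) => hB //; exfalso.
    by apply: (@comb_neq A C (- B) q p r); rewrite ?oppr_ge0 // 1?eq_sym //; lra.
  by apply: (@comb_neq (- A) B (- C) p q r); rewrite ?oppr_ge0 ?pq // 1?eq_sym //; lra.
- have -> : (0 < C) = (0 < A); last by rewrite -qr pq /= addbF addbb.
  case: (ltP 0 C) => hC; case: (ltP 0 A) => hA //; exfalso.
    by apply: (@comb_neq B C (- A) q r p); rewrite ?oppr_ge0 //; lra.
  by apply: (@comb_neq (- B) A (- C) r q p); rewrite ?oppr_ge0 -?qr //; lra.
have rp : lexpos r = lexpos p by move: pq qr; case: (lexpos p); case: (lexpos q); case: (lexpos r).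
have -> : (0 < B) = ~~ (0 < A).
  case: (ltP 0 B) => hB; case: (ltP 0 A) => hA //; exfalso.
    by apply: (@comb_neq C B A p r q); rewrite ?rp 1?eq_sym //; try exact: ltW; lra.
  (* In the degenerate case [A = B = 0], [p] and [q] are parallel and on the same side of the line
     orthogonal to [u], hence positive multiples of each other. *)
  have [AB0|AB0] : (A = 0 /\ B = 0) \/ 0 < (- B) + (- A) by lra.
    have [A0 B0] := AB0; apply: (@comb_neq (dot2 u p) (dot2 u q) 0 p p q) => //.
    - transitivity (dot2 u q * p.1 + 0 * p.1 - u.2 * A); first by rewrite /A /det2 /dot2; ring.
      by rewrite A0; ring.
    - transitivity (dot2 u q * p.2 + 0 * p.2 + u.1 * A); first by rewrite /A /det2 /dot2; ring.
      by rewrite A0; ring.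
    - exact: ltW.
    - by rewrite addr0.
    - by rewrite eq_sym.
  by apply: (@comb_neq (- C) (- B) (- A) p r q); rewrite ?oppr_ge0 ?rp 1?eq_sym //; lra.
by rewrite rp; move: pq; case: (lexpos p); case: (lexpos q) => //= _; case: (0 < A).
Qed.
End Crossing.

(** * Sums modulo 2 over a grid *)

Lemma strip_parity (hz0 hz1 vt : nat -> bool) n :
  (forall i, i < n -> hz0 i (+) vt i.+1 (+) hz1 i (+) vt i = false) ->
  \big[addb/false]_(i < n) hz0 i (+) vt n (+) \big[addb/false]_(i < n) hz1 i (+) vt 0 = false.
Proof.
elim: n => [|n IH] cells; first by rewrite !big_ord0 /= addbF addbb.
rewrite !big_ord_recr /=; have := IH (fun i i_n => cells i (ltnW i_n)); have := cells n (ltnSn n).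
set a := \big[addb/false]_(i < n) hz0 i; set b := \big[addb/false]_(i < n) hz1 i.
by case: (hz0 n); case: (vt n.+1); case: (hz1 n); case: (vt n); case: (vt 0); case: a; case: b.
Qed.

(** A discrete Green formula over F_2: a side shared by two cells cancels, and the boundary of the
    grid remains. *)
Lemma grid_parity (hz vt : nat -> nat -> bool) n m :
  (forall i j, i < n -> j < m -> hz i j (+) vt i.+1 j (+) hz i j.+1 (+) vt i j = false) ->
  \big[addb/false]_(i < n) hz i 0 (+) \big[addb/false]_(j < m) vt n j (+)
  \big[addb/false]_(i < n) hz i m (+) \big[addb/false]_(j < m) vt 0 j = false.
Proof.
elim: m => [|m IH] cells; first by rewrite !big_ord0 !addbF addbb.
rewrite ![\big[_/_]_(_ < m.+1) _]big_ord_recr /=.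
have := IH (fun i j i_n j_m => cells i j i_n (ltnW j_m)).
have := @strip_parity (hz ^~ m) (hz ^~ m.+1) (vt ^~ m) n (fun i i_n => cells i m i_n (ltnSn m)).
move: (\big[addb/false]_(i < n) hz i m) (\big[addb/false]_(i < n) hz i m.+1) => a b.
move: (\big[addb/false]_(i < n) hz i 0) (\big[addb/false]_(j < m) vt n j).
move: (\big[addb/false]_(j < m) vt 0 j) => d e f.
by case: a; case: b; case: (vt n m); case: (vt 0 m) => /=; case: d; case: e; case: f.
Qed.

Lemma telescope_addb (h : nat -> bool) n :
  \big[addb/false]_(i < n) (h i (+) h i.+1) = h 0 (+) h n.
Proof.
elim: n => [|n IH]; first by rewrite big_ord0 addbb.
by rewrite big_ord_recr /= IH; case: (h 0); case: (h n); case: (h n.+1).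
Qed.

(** * Uniform separation of two disjoint arcs *)

Section Arcs.
Local Open Scope ring_scope.
Local Open Scope classical_set_scope.
Variable R : realType.

Lemma dot2_diff_self (z w : R * R) : z <> w -> 0 < dot2 (z - w) z - dot2 (z - w) w.
Proof.
case: z w => [z1 z2] [w1 w2] zw; rewrite /dot2 /=.
have -> : (z1 - w1) * z1 + (z2 - w2) * z2 - ((z1 - w1) * w1 + (z2 - w2) * w2)
  = (z1 - w1) ^+ 2 + (z2 - w2) ^+ 2 by ring.
rewrite lt0r addr_ge0 ?sqr_ge0 // andbT paddr_eq0 ?sqr_ge0 // !sqrf_eq0 !subr_eq0.
by apply/negP => /andP[/eqP e1 /eqP e2]; apply: zw; rewrite e1 e2.
Qed.

Lemma arc_dot2_near (f : R -> R * R) (u : R * R) (s eps : R) :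
  {within `[0, 1], continuous f} -> `[0, 1] s -> 0 < eps ->
  exists2 del, 0 < del & forall s', `[0, 1] s' -> `|s - s'| < del ->
    `|dot2 u (f s) - dot2 u (f s')| < eps.
Proof.
move=> /subspace_continuousP cf s01 eps0.
have cd : (fun t => dot2 u (f t)) @ within `[0, 1] (nbhs s) --> dot2 u (f s).
  have cfs := cf _ s01.
  apply: cvgD; apply: cvgM; try exact: cvg_cst.
    exact: (cvg_comp _ _ cfs (@cvg_fst _ _ _ _ _)).
  exact: (cvg_comp _ _ cfs (@cvg_snd _ _ _ _ _)).
move/cvgrPdist_lt : cd => /(_ _ eps0).
rewrite near_withinE => /nbhs_ballP [del /= del0 ball_del].
by exists del => // s' s'01 ss'; apply: ball_del.
Qed.

Lemma unit_itv_compact_prod : compact (`[0, 1] `*` `[0, 1] : set (R * R)).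
Proof. by apply: compact_setX; exact: segment_compact. Qed.

(** Near [(s0, t0)] the direction [f s0 - g t0] itself serves as [u], by continuity; compactness of
    the unit square then yields one mesh for all points. *)
Lemma arcs_locally_on_one_side (f g : R -> R * R) :
  {within `[0, 1], continuous f} -> {within `[0, 1], continuous g} ->
  (forall s t, `[0, 1] s -> `[0, 1] t -> f s <> g t) ->
  \forall N \near \oo, forall s t, `[0, 1] s -> `[0, 1] t -> exists u,
    forall s' t', `[0, 1] s' -> `[0, 1] t' ->
    `|s - s'| <= N.+1%:R^-1 -> `|t - t'| <= N.+1%:R^-1 -> 0 < dot2 u (f s' - g t').
Proof.
move=> cf cg fg.
pose P (N : nat) (st : R * R) := exists u,
    forall s' t', `[0, 1] s' -> `[0, 1] t' ->
    `|st.1 - s'| <= N.+1%:R^-1 -> `|st.2 - t'| <= N.+1%:R^-1 -> 0 < dot2 u (f s' - g t').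
have /compact_near_coveringP/near_covering_withinP cov := unit_itv_compact_prod.
have : \forall N \near \oo, `[0, 1] `*` `[0, 1] `<=` P N.
  apply: cov => -[s0 t0] [/= s01 t01].
  (* [e] is half the squared length of [u], so errors below [e] on both arcs keep the product
     positive. The radii [d1] and [d2] are halved below, one half for moving the centre and one for
     the mesh. *)
  pose u := f s0 - g t0; pose e := (dot2 u (f s0) - dot2 u (g t0)) / 2.
  have e0 : 0 < e by rewrite divr_gt0 //; exact/dot2_diff_self/fg.
  have [d1 d1_gt0 fd1] := arc_dot2_near u cf s01 e0.
  have [d2 d2_gt0 gd2] := arc_dot2_near u cg t01 e0.
  have d1_2 : 0 < d1 / 2 by rewrite divr_gt0.
  have d2_2 : 0 < d2 / 2 by rewrite divr_gt0.
  near=> st N; move=> _; exists u; move=> s' t' s'01 t'01 ss' tt'.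
  have : ball (s0, t0) (Num.min (d1 / 2) (d2 / 2)) st.
    by near: st; apply: nbhsx_ballx; rewrite lt_min d1_2 d2_2.
  move=> [/= bs bt].
  have Nd1 : N.+1%:R^-1 < d1 / 2 by near: N; exact: (near_infty_natSinv_lt (PosNum d1_2)).
  have Nd2 : N.+1%:R^-1 < d2 / 2 by near: N; exact: (near_infty_natSinv_lt (PosNum d2_2)).
  have := fd1 _ s'01; have := gd2 _ t'01.
  have -> : `|s0 - s'| < d1.
    have -> : s0 - s' = (s0 - st.1) + (st.1 - s') by ring.
    rewrite (le_lt_trans (ler_normD _ _)) // (splitr d1) ltrD //.
      by rewrite (lt_le_trans bs) // ge_min lexx.
    exact: le_lt_trans Nd1.
  have -> : `|t0 - t'| < d2.
    have -> : t0 - t' = (t0 - st.2) + (st.2 - t') by ring.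
    rewrite (le_lt_trans (ler_normD _ _)) // (splitr d2) ltrD //.
      by rewrite (lt_le_trans bt) // ge_min lexx orbT.
    exact: le_lt_trans Nd2.
  move=> /(_ isT) ht /(_ isT) hs.
  have -> : dot2 u (f s' - g t') = dot2 u (f s') - dot2 u (g t') by rewrite /dot2 /=; ring.
  have e2 : dot2 u (f s0) - dot2 u (g t0) = 2 * e by rewrite /e; field.
  move: ht hs; rewrite !ltr_norml => /andP[h1 h2] /andP[h3 h4].
  by lra.
apply: filterS => N NP s t s01 t01.
by have [|u uP] := NP (s, t); [split | exists u].
Unshelve. all: end_near. Qed.
End Arcs.

(** * Crossing parities in a plane drawing *)

Section PlanarParity.
Local Open Scope ring_scope.
Local Open Scope classical_set_scope.
Variable R : realType.

Definition sample (N i : nat) : R := i%:R / N.+1%:R.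

Lemma sample01 N i : (i <= N.+1)%N -> `[0, 1] (sample N i).
Proof.
move=> iN; rewrite /sample /= in_itv /= divr_ge0 //=.
by rewrite ler_pdivrMr ?ltr0Sn // mul1r ler_nat.
Qed.

Lemma sample_step N i : `|sample N i - sample N i.+1| <= N.+1%:R^-1.
Proof.
rewrite /sample -mulrBl -[i.+1]addn1 natrD opprD addrA subrr sub0r mulN1r normrN.
by rewrite ger0_norm.
Qed.

(* Parity of the number of crossings of the ray from [z] in direction (1, 0)
   with the polygonal approximation of [f] on the [N + 1]-fold subdivision. *)
Definition ray_parity (N : nat) (f : R -> R * R) (z : R * R) : bool :=
  \big[addb/false]_(i < N.+1) cross (f (sample N i) - z) (f (sample N i.+1) - z).

(** The left side counts crossings of [g] with the opposite ray from [z]. The two rays form a line,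
    and the polygon crosses it with the parity of the change of side between its ends. *)
Lemma ray_parityN (N : nat) (g : R -> R * R) (z : R * R) :
  (forall t, `[0, 1] t -> g t <> z) ->
  \big[addb/false]_(j < N.+1) cross (z - g (sample N j)) (z - g (sample N j.+1))
  = ray_parity N g z (+) (lexpos (z - g 0) (+) lexpos (z - g 1)).
Proof.
move=> gz.
have nz j : (j <= N.+1)%N -> z - g (sample N j) != 0.
  move=> jN; rewrite subr_eq0; apply/eqP => e.
  exact: (gz (sample N j) (sample01 jN)).
pose h j := lexpos (z - g (sample N j)).
have -> : lexpos (z - g 0) (+) lexpos (z - g 1) = h 0%N (+) h N.+1.
  by rewrite /h /sample mul0r divff.
rewrite /ray_parity -telescope_addb -big_split /=; apply: eq_bigr => -[j jN] _ /=.
rewrite -![g _ - z]opprB crossN ?nz // 1?ltnW //.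
by rewrite /h; case: (cross _ _); case: (lexpos _); case: (lexpos _).
Qed.

(** The boundary of the square of differences has four sides: [f] seen from the two ends of [g], and
    the two ends of [f] minus [g]. Turning the latter into rays issued from the ends of [f] produces
    the [lexpos] terms. *)
Lemma disjoint_arcs_parity (f g : R -> R * R) :
  {within `[0, 1], continuous f} -> {within `[0, 1], continuous g} ->
  (forall s t, `[0, 1] s -> `[0, 1] t -> f s <> g t) ->
  \forall N \near \oo,
    ray_parity N f (g 0) (+) ray_parity N f (g 1) (+) ray_parity N g (f 0) (+) ray_parity N g (f 1)
    = lexpos (f 0 - g 0) (+) lexpos (f 0 - g 1) (+) lexpos (f 1 - g 0) (+) lexpos (f 1 - g 1).
Proof.
move=> cf cg fg; apply: filterS (arcs_locally_on_one_side cf cg fg) => N NP.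
pose F i j := f (sample N i) - g (sample N j).
pose hz i j := cross (F i j) (F i.+1 j); pose vt i j := cross (F i j) (F i j.+1).
have cells i j : (i < N.+1)%N -> (j < N.+1)%N ->
    hz i j (+) vt i.+1 j (+) hz i j.+1 (+) vt i j = false.
  move=> iN jN; have [u uP] := NP _ _ (sample01 (ltnW iN)) (sample01 (ltnW jN)).
  have sub0 k : `|sample N k - sample N k| <= N.+1%:R^-1 by rewrite subrr normr0.
  have u00 : 0 < dot2 u (F i j) by apply: uP => //; exact/sample01/ltnW.
  have u10 : 0 < dot2 u (F i.+1 j).
    by apply: uP => //; [exact: sample01|exact/sample01/ltnW|exact: sample_step].
  have u01 : 0 < dot2 u (F i j.+1).
    by apply: uP => //; [exact/sample01/ltnW|exact: sample01|exact: sample_step].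
  have u11 : 0 < dot2 u (F i.+1 j.+1).
    by apply: uP; try exact: sample01; exact: sample_step.
  (* Each cell is cut along a diagonal into two triangles, and the diagonal cancels. *)
  have := cross_triangle u00 u10 u11; have := cross_triangle u00 u01 u11.
  by rewrite /hz /vt; do 5 case: (cross _ _).
have := grid_parity cells; rewrite /hz /vt.
have s0 : sample N 0 = 0 by rewrite /sample mul0r.
have s1 : sample N N.+1 = 1 by rewrite /sample divff.
have i0 : `[0, 1] (0 : R) by rewrite /= in_itv /= lexx ler01.
have i1 : `[0, 1] (1 : R) by rewrite /= in_itv /= lexx ler01.
rewrite /F s0 s1 -/(ray_parity N f (g 0)) -/(ray_parity N f (g 1)) !ray_parityN.
- by do 4 case: (ray_parity _ _ _); do 4 case: (lexpos _).
- by move=> t t01 e; apply: (fg 0 t) => //; rewrite e.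
- by move=> t t01 e; apply: (fg 1 t) => //; rewrite e.
Qed.

Lemma planar_parity (V : finType) (G : sgraph V) : planar R G ->
  exists (m : V -> V -> V -> nat) (o : V -> V -> nat),
    (forall u v, u != v -> o u v + o v u = 1)%N /\
    (forall a b c d, G a b -> G c d -> a != c -> a != d -> b != c -> b != d ->
     exists k, m c a b + m d a b + m a c d + m b c d
               + (o a c + o a d + o b c + o b d) = 2 * k)%N.
Proof.
move=> [p [D [pinj arcs _ meet]]].
have param (uv : V * V) : exists f : R -> R * R, G uv.1 uv.2 ->
    [/\ {within `[0, 1], continuous f}, f 0 = p uv.1, f 1 = p uv.2
      & D uv.1 uv.2 = f @` `[0, 1]].
  case: uv => u v /=; case Guv: (G u v); last by exists (cst 0).
  by have [[f [cf _ f0 f1 Df]] _] := arcs _ _ Guv; exists f.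
have [f fP] := choice param.
pose good N (q : V * V * (V * V)) :=
  G q.1.1 q.1.2 -> G q.2.1 q.2.2 -> q.1.1 != q.2.1 -> q.1.1 != q.2.2 ->
  q.1.2 != q.2.1 -> q.1.2 != q.2.2 ->
  ray_parity N (f q.1) (p q.2.1) (+) ray_parity N (f q.1) (p q.2.2)
  (+) ray_parity N (f q.2) (p q.1.1) (+) ray_parity N (f q.2) (p q.1.2)
  = lexpos (p q.1.1 - p q.2.1) (+) lexpos (p q.1.1 - p q.2.2)
    (+) lexpos (p q.1.2 - p q.2.1) (+) lexpos (p q.1.2 - p q.2.2).
have : \forall N \near \oo, forall q, good N q.
  (* One subdivision must serve all pairs of edges, so that equal terms of different relations
     agree; the pairs are finite in number. *)
  apply: filter_forall => -[[a b] [c d]]; rewrite /good /=.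
  case ab: (G a b); last by apply: nearW.
  case cd: (G c d); last by apply: nearW.
  case: (boolP [&& a != c, a != d, b != c & b != d]); last first.
    by move=> H; apply: nearW => N _ _ *; case/negP: H; apply/and4P; split.
  case/and4P=> ac ad bc bd.
  have [cf f0 f1 Df] := fP (a, b) ab; have [cg g0 g1 Dg] := fP (c, d) cd.
  have := disjoint_arcs_parity cf cg; rewrite f0 f1 g0 g1 /= => H.
  apply: filterS (H _) => [N ? //|s t s01 t01 e].
  have zD : D a b (f (a, b) s) by rewrite Df; exists s.
  have zD' : D c d (f (a, b) s) by rewrite Dg e; exists t.
  (* Used in both orders, [meet] makes a common point an end of both edges, against the injectivity
     of [p]. *)
  have := meet a b c d ab cd; rewrite !inE !xpair_eqE negb_or !negb_and.
  rewrite ![c == _]eq_sym ac bc /= => /(_ isT _ (conj zD zD')) h1.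
  have := meet c d a b cd ab; rewrite !inE !xpair_eqE negb_or !negb_and.
  rewrite ac ad /= => /(_ isT _ (conj zD' zD)) h2.
  by case: h1 h2 => [->|->] [/pinj/eqP|/pinj/eqP]; rewrite ?(negbTE ac) ?(negbTE ad) ?(negbTE bc) ?(negbTE bd).
move=> /filter_ex [N Ngood].
exists (fun v u w => ray_parity N (f (u, w)) (p v)), (fun u v => lexpos (p u - p v)); split.
  move=> u v uv; rewrite -[p v - _]opprB lexposN; first by case: (lexpos _).
  by rewrite subr_eq0; apply: contra_neq uv => /pinj.
move=> a b c d ab cd ac ad bc bd.
have := Ngood ((a, b), (c, d)) ab cd ac ad bc bd => /=.
(* Eight bits with an even sum: half of it is at most 4. *)
do 4 case: (ray_parity _ _ _); (do 4 case: (lexpos _)); move=> //= _;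
  by [exists 0%N|exists 1%N|exists 2%N|exists 3%N|exists 4%N].
Qed.
End PlanarParity.

(** * Rooted trees *)

Lemma planar_no_K33 (R : realType) (V : finType) (G : sgraph V)
    (A B : 'I_3 -> V) (S : 'I_3 -> 'I_3 -> V -> Prop) : planar R G ->
  (forall i j, conn_in G (S i j) (A i) (B j)) ->
  (forall (i j k l : 'I_3) z, (i < k)%N -> j != l -> S i j z -> S k l z -> False) -> False.
Proof.
move=> /planar_parity[m [s [s_anti m_rel]]] AB dis.
apply: (no_K33 s_anti m_rel AB) => i j k l z ik jl Sij Skl.
have [lt_ik|lt_ki|/val_inj e] := ltngtP i k; first exact: (dis i j k l z).
  by apply: (dis k l i j z); rewrite // eq_sym.
by rewrite e eqxx in ik.
Qed.

Lemma conn_in_mono (V : finType) (G G' : rel V) (S S' : V -> Prop) x y :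
  subrel G G' -> (forall z, S z -> S' z) -> conn_in G S x y -> conn_in G' S' x y.
Proof.
move=> GG' SS' [p [xp lp Sp]]; exists p; split=> //; first exact: sub_path xp.
by move=> z /Sp/SS'.
Qed.

Lemma conn_in_sym (V : finType) (G : rel V) (S : V -> Prop) x y :
  symmetric G -> conn_in G S x y -> conn_in G S y x.
Proof.
move=> Gsym [p [xp <- Sp]]; exists (rev (belast x p)); split.
- by rewrite (eq_path (e' := fun z : V => G^~ z)) ?rev_path // => u v; rewrite Gsym.
- by case: p {xp Sp} => //= z p; rewrite rev_cons last_rcons.
by move=> z; rewrite -rev_rcons mem_rev -lastI => /Sp.
Qed.

Section Tree.
Variables (V : finType) (T : sgraph V).

Lemma acyclic_bridge x y : acyclic T -> T x y ->
  ~~ connect [rel u v | T u v && ((u, v) \notin [:: (x, y); (y, x)])] x y.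
Proof.
move=> acT xy; apply/negP => /connectP[p]; case/shortenP=> q xq uq _ yq.
have Tq : path T x q by apply: sub_path xq => u v /andP[].
have : (size (x :: q) <= 2)%N.
  by apply: acT; rewrite /ucycle uq andbT /cycle rcons_path Tq -yq adj_sym.
case: q xq yq {uq Tq} => [|z [|//]] /=; first by move=> _ e; rewrite e adj_irr in xy.
by rewrite andbT => /andP[_ zy] e _; rewrite -e !inE eqxx in zy.
Qed.

Lemma leaf_neighbor x y z : leaf T x -> T x y -> T x z -> y = z.
Proof.
rewrite /leaf /degree => /eqP/mem_card1[w Tw] xy xz.
by have := Tw y; have := Tw z; rewrite !inE xy xz => /esym/eqP -> /esym/eqP ->.
Qed.

(** [d] is the distance from [r], and [par] the last but one vertex of a shortest path. An edge that
    joins no vertex to its parent is avoided by the climbs from both its ends to [r], so it would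
    not be a bridge. *)
Lemma rooted_tree r : is_tree T -> exists (par : V -> V) (d : V -> nat),
  [/\ d r = 0%N, par r = r, forall x, x != r -> T x (par x) /\ d x = (d (par x)).+1
    & forall x y, T x y -> (x != r /\ par x = y) \/ (y != r /\ par y = x)].
Proof.
move=> [_ conT acT].
pose P n v := exists p, [/\ path T r p, last r p = v & size p = n].
have dist v : exists n, P n v /\ forall m, P m v -> (n <= m)%N.
  have exP : exists n, `[< P n v >].
    by have /connectP[p rp ->] := conT r v; exists (size p); apply/asboolP; exists p.
  exists (ex_minn exP); case: ex_minnP => n /asboolP Pn min_n; split=> // m Pm.
  by apply: min_n; apply/asboolP.
have [d dP] := choice dist.
have dr : d r = 0%N by apply/eqP; rewrite -leqn0; apply: (proj2 (dP r)); exists [::].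
have parent x : exists y, if x == r then y = r else T x y /\ d x = (d y).+1.
  case: eqVneq => [_|xr]; first by exists r.
  have [[p [rp lp sp]] _] := dP x; case/lastP: p rp lp sp => [_ /= e|p z].
    by rewrite e eqxx in xr.
  rewrite rcons_path last_rcons size_rcons => /andP[rp pz] zx sp; subst z.
  exists (last r p); rewrite adj_sym pz; split=> //.
  have [[q [rq lq sq]] min_q] := dP (last r p).
  have /min_q dp : P (size p) (last r p) by exists p.
  have dx : (d x <= (d (last r p)).+1)%N.
    apply: (proj2 (dP x)); exists (rcons q x).
    by rewrite rcons_path rq lq last_rcons size_rcons sq.
  by apply/eqP; rewrite eqn_leq dx -sp ltnS dp.
have [par parP] := choice parent.
exists par, d; split=> //.
- by have := parP r; rewrite eqxx.
- by move=> x xr; have := parP x; rewrite (negbTE xr).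
move=> x y xy; case: (pselect (x != r /\ par x = y)) => xy_par; first by left.
case: (pselect (y != r /\ par y = x)) => yx_par; [by right|exfalso].
have /negP := acyclic_bridge acT xy; apply.
set T' := (X in connect X).
have T'sym : connect_sym T'.
  apply: sym_connect_sym => u v; rewrite /T' /= adj_sym !inE !xpair_eqE.
  by congr (_ && ~~ _); rewrite orbC [(v == y) && _]andbC [(v == x) && _]andbC.
have to_root n v : d v = n -> connect T' v r.
  elim: n v => [|n IH] v dv; have := parP v; case: eqVneq => [-> //|vr] [vp dvp].
    by rewrite dv in dvp.
  apply: connect_trans (IH (par v) _); last by apply/succn_inj; rewrite -dvp.
  apply: connect1; rewrite /T' /= vp !inE !xpair_eqE negb_or !negb_and /=.
  apply/andP; split; case: eqVneq => //= e; subst v; apply/eqP => e.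
    by apply: xy_par.
  by apply: yx_par.
by apply: (connect_trans (to_root _ x erefl)); rewrite T'sym; apply: to_root.
Qed.
End Tree.

Lemma index_next (V : eqType) (c : seq V) x : uniq c -> x \in c ->
  index (next c x) c = (index x c).+1 %% size c.
Proof.
case: c => // z c uc xc; rewrite next_nth xc.
have : index x (z :: c) < (size c).+1 by rewrite index_mem.
move: (index _ _) => i; rewrite ltnS leq_eqVlt => /orP[/eqP ->|ic].
  by rewrite nth_default //= eqxx modnn.
by rewrite modn_small // -[nth z c i]/(nth z (z :: c) i.+1) index_uniq.
Qed.

Lemma cycle_adjE (V : finType) (c : seq V) x y : uniq c -> x \in c -> y \in c ->
  cycle_adj c x y = (index y c == (index x c).+1 %% size c)
                 || (index x c == (index y c).+1 %% size c).
Proof.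
have idx_eq z w : uniq c -> w \in c -> (z == w) = (index z c == index w c).
  move=> uc wc; apply/eqP/eqP => [-> //|e].
  have zc : z \in c by rewrite -index_mem e index_mem.
  by rewrite -(nth_index w zc) e nth_index.
move=> uc xc yc; rewrite /cycle_adj /= xc yc /=.
by rewrite (idx_eq _ y) // (idx_eq _ x) // !index_next // ![index _ c == _ %% _]eq_sym.
Qed.

Lemma conn_in_trans (V : finType) (G : rel V) (S : V -> Prop) x y z :
  conn_in G S x y -> conn_in G S y z -> conn_in G S x z.
Proof.
move=> [p [xp lp Sp]] [q [yq lq Sq]]; exists (p ++ q); rewrite cat_path last_cat xp lp; split=> //.
move=> w; rewrite -cat_cons mem_cat => /orP[/Sp //|wq].
by apply: Sq; rewrite inE wq orbT.
Qed.

Section RootedTree.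
Variables (V : finType) (T : sgraph V) (r : V) (par : V -> V) (d : V -> nat).
Hypotheses (dr : d r = 0) (parr : par r = r).
Hypothesis parP : forall x, x != r -> T x (par x) /\ d x = (d (par x)).+1.
Hypothesis T_par : forall x y, T x y -> (x != r /\ par x = y) \/ (y != r /\ par y = x).

(** [x] lies in the subtree of [v]: the ancestor comes first, reversing the order in [fconnect]. As
    [par] fixes [r], every climb ends there. *)
Notation below v x := (fconnect par x v).

Lemma below_depth v x : below v x -> d v <= d x /\ (d v = d x -> v = x).
Proof.
move=> /iter_findex; move: (findex par x v) => n <-; elim: n x => [|n IH] x; first by [].
rewrite iterSr; have [-> |xr] := eqVneq x r.
  by have := IH r; rewrite parr.
have [le_d eq_d] := IH (par x); have [_ dx] := parP xr.
by split=> [|e]; [lia|exfalso; lia].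
Qed.

Lemma below_step v x : below v x -> v != x -> x != r /\ below v (par x).
Proof.
move=> vx nvx; have := iter_findex vx; case: (findex par x v) => [/= e|n].
  by rewrite e eqxx in nvx.
rewrite iterSr => e; have px : below v (par x) by rewrite -e fconnect_iter.
split=> //; apply: contra_neq nvx => xr; move: e; rewrite xr parr => <-.
by elim: n => //= n ->.
Qed.

Lemma below_rootN x : below x r -> x = r.
Proof. by case: (eqVneq x r) => // xr /below_step /(_ xr) []; rewrite eqxx. Qed.

Lemma below_chain v w x : below v x -> below w x -> below v w \/ below w v.
Proof.
move=> /iter_findex; move: (findex _ _ _) => n <-.
move=> /iter_findex; move: (findex _ _ _) => m <-.
case: (leqP n m) => nm; [right|left].
  by rewrite -(subnK nm) iterD fconnect_iter.
by rewrite -(subnK (ltnW nm)) iterD fconnect_iter.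
Qed.

Lemma below_anti v w : below v w -> below w v -> v = w.
Proof. by move=> /below_depth[? e] /below_depth[? _]; apply: e; lia. Qed.

Lemma T_parE x y : T x y = (x != r) && (par x == y) || (y != r) && (par y == x).
Proof.
apply/idP/idP; first by move=> /T_par[[-> ->]|[-> ->]]; rewrite eqxx ?orbT.
case/orP=> /andP[/parP[Tp _] /eqP <- //]; by rewrite adj_sym.
Qed.

Lemma climb v x : below v x ->
  conn_in T (fun z => below v z /\ below z x) x v.
Proof.
move: {2}(d x) (erefl (d x)) => n; elim: n x => [|n IH] x dx vx; have [->|vnx] := eqVneq v x;
  try exact: conn_in_refl.
  by have [/parP[_]] := below_step vx vnx; rewrite dx.
have [/parP[Tp dpx] vp] := below_step vx vnx.
apply: conn_in_step Tp _; first by [].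
apply: conn_in_mono (IH _ _ vp); [by []| |lia].
by move=> z [vz zp]; split=> //; exact: connect_trans (fconnect1 _ _) zp.
Qed.

Lemma leaf_below z x : leaf T z -> z != r -> below z x -> x = z.
Proof.
move=> lz zr; move: {2}(d x) (erefl (d x)) => n; elim: n x => [|n IH] x dx zx.
  by have [//|zx'] := eqVneq z x; have [/parP[_]] := below_step zx zx'; rewrite dx.
have [//|zx'] := eqVneq z x; have [xr zpx] := below_step zx zx'.
have [Tx dpx] := parP xr; have pxz : par x = z by apply: IH zpx; lia.
have [Tz dz] := parP zr; rewrite pxz adj_sym in Tx.
by have e := leaf_neighbor lz Tz Tx; rewrite pxz in dpx; rewrite e in dz; lia.
Qed.

(** A deepest vertex below [v] has no child, so its parent is its only neighbour. *)
Lemma leaf_above v : v != r -> exists x, [/\ leaf T x, x != r & below v x].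
Proof.
move=> vr; case: (@arg_maxnP _ v (fun x => below v x) d) => [|x vx max_x].
  exact: connect0.
have [dv _] := below_depth vx; have [_ dpv] := parP vr.
have xr : x != r by apply: contraTneq dv => ->; rewrite dr dpv.
exists x; split=> //; rewrite /leaf /degree -(card1 (par x)); apply/eqP/eq_card => y.
rewrite !inE T_parE xr /= eq_sym; case: (eqVneq y (par x)) => //= yx.
apply/andP => -[yr /eqP pyx]; have [_ dy] := parP yr.
have vy : below v y by apply: connect_trans vx; rewrite -pyx fconnect1.
by have := max_x y vy; rewrite /= dy pyx; lia.
Qed.
End RootedTree.

(** * Box layouts *)

Lemma nat_box_representable (R : realType) (V : finType) (G : sgraph V) (xl xr yl yr : V -> nat) :
  (forall v, xl v <= xr v) -> (forall v, yl v <= yr v) ->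
  (forall u v, u != v ->
    G u v = [&& xl u <= xr v, xl v <= xr u, yl u <= yr v & yl v <= yr u]) ->
  box_representable R G 2.
Proof.
move=> xlr ylr GE.
pose a v (i : 'I_2) : R := (if i == 0%R then xl v else yl v)%:R%R.
pose b v (i : 'I_2) : R := (if i == 0%R then xr v else yr v)%:R%R.
exists (fun v => [set x | forall i, x i \in `[a v i, b v i]%R]%classic); split.
  by move=> v; exists (a v), (b v); split=> // i; rewrite /a /b ler_nat; case: ifP.
move=> u v uv; rewrite GE //; split.
  case/and4P=> h1 h2 h3 h4.
  exists (fun i => (if i == 0%R then maxn (xl u) (xl v) else maxn (yl u) (yl v))%:R%R).
  split=> i; rewrite /= in_itv /= /a /b !ler_nat; case: ifP => _;
    by rewrite ?leq_max ?geq_max ?leqnn ?orbT ?xlr ?ylr ?h1 ?h2 ?h3 ?h4.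
move=> [x [/= xu xv]].
have meet i : (a u i <= b v i)%R && (a v i <= b u i)%R.
  have := xu i; have := xv i; rewrite !in_itv /= => /andP[h1 h2] /andP[h3 h4].
  by rewrite (le_trans h3 h2) (le_trans h1 h4).
have := meet 0%R; have := meet 1%R; rewrite /a /b /= !ler_nat => /andP[-> ->] /andP[-> ->].
by [].
Qed.

Lemma and4_eq (a b c d e : bool) : (a -> b -> c -> d -> e) -> (e -> [/\ a, b, c & d]) ->
  [&& a, b, c & d] = e.
Proof.
case: e => [_ /(_ isT)[-> -> -> ->] //|H _]; apply: negbTE; apply/negP => /and4P[ha hb hc hd].
by have := H ha hb hc hd.
Qed.

(* The boxes for [size c = K + 4], with coordinates scaled by 2. The inner vertex
   [v] occupies the columns [L v, U v] and the rows [d v, d v + 1]; a leaf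
   continues down its column to the bottom row [H] and touches its neighbours
   there. The chain of vertices that lie only above the first leaf leaves the
   deepest vertex of depth [D1] having a second leaf below it, and runs
   horizontally to the left at depth [D1 + 1/2] up to the first leaf, which is a
   vertical bar meeting the root at the top and the second leaf at the bottom. The
   last leaf is treated symmetrically. *)
Section BoxesFour.
Variables K B H D1 D2 i1 i2 : nat.

(** [B] is column 0 and [B + 2 * K + 8] column [K + 4], just outside the columns of the leaves; the
    chains run outwards from there with step 1. A middle leaf is widened by 1 towards a neighbouring
    middle leaf. The second leaf extends to [B - i1], the right end of the first one. *)
Definition left4 (d L U : nat) (lf : bool) : nat :=
  if U == 1 then B - (d - D1) else if L == K + 3 then B + 2 * K + 8 + (d - D2.+1)
  else if lf then (if L == 2 then B - i1 else B + 2 * L - 1)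
  else if (L == 1) && (d == D1) then B else B + 2 * L.
Definition right4 (d L U : nat) (lf : bool) : nat :=
  if U == 1 then B - (d - D1) + 1 else if L == K + 3 then B + 2 * K + 8 + (d - D2.+1) + 1
  else if lf then (if L == K + 2 then B + 2 * K + 8 + i2 else B + 2 * L + 1)
  else if (U == K + 3) && (d == D2) then B + 2 * K + 8 else B + 2 * U.
(** The second coordinate grows with the depth, so the bottom of a box faces the root. A second
    leaf, being deeper than [D1], starts beyond the row [2 * D1 + 1] and passes the chain without
    touching it. *)
Definition bottom4 (d L U : nat) (lf : bool) : nat :=
  if U == 1 then (if lf then 0 else 2 * D1 + 1)
  else if L == K + 3 then (if lf then 0 else 2 * D2 + 1) else 2 * d.
Definition top4 (d L U : nat) (lf : bool) : nat :=
  if U == 1 then (if lf then 2 * H else 2 * D1 + 1)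
  else if L == K + 3 then (if lf then 2 * H else 2 * D2 + 1)
  else if lf then 2 * H else 2 * d + 2.

Definition admissible4 (d L U : nat) (lf : bool) : Prop :=
  [/\ [/\ 0 < d, d < H, 0 < L, L <= U & U <= K + 3],
      [/\ L = 1 -> 1 < U -> d <= D1, U = 1 -> D1 < d
        & U = 1 -> if lf then d = D1 + i1 + 1 else d <= D1 + i1],
      [/\ U = K + 3 -> L < K + 3 -> d <= D2, L = K + 3 -> D2 < d
        & L = K + 3 -> if lf then d = D2 + i2 + 1 else d <= D2 + i2]
    & lf -> [/\ L = U, L = 2 -> D1 < d & L = K + 2 -> D2 < d]].

Hypotheses (HB : H <= B).
Hypotheses (D1_gt0 : 0 < D1) (D1i1 : D1 + i1 < H) (D2_gt0 : 0 < D2) (D2i2 : D2 + i2 < H).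

(* The kinds of non-root vertices: inner vertices and leaves in the middle,
   then inner vertices and leaf of the leftmost and of the rightmost chain. *)
Inductive kind4 (d L U : nat) : bool -> nat -> nat -> nat -> nat -> Prop :=
| Inner4 xl xr of 1 < U & L < K + 3 &
    L = 1 /\ d = D1 /\ xl = B \/ xl = B + 2 * L /\ (1 < L \/ d < D1) &
    U = K + 3 /\ d = D2 /\ xr = B + 2 * K + 8 \/ xr = B + 2 * U /\ (U < K + 3 \/ d < D2) :
    kind4 d L U false xl xr (2 * d) (2 * d + 2)
| Leaf4 xl xr of L = U & 1 < L & L < K + 3 &
    L = 2 /\ D1 < d /\ xl + i1 = B \/ 2 < L /\ xl + 1 = B + 2 * L &
    L = K + 2 /\ D2 < d /\ xr = B + 2 * K + 8 + i2 \/ L < K + 2 /\ xr = B + 2 * L + 1 :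
    kind4 d L U true xl xr (2 * d) (2 * H)
| LeftInner4 xl e of U = 1 & L = 1 & 0 < e & e <= i1 & d = D1 + e & xl + e = B :
    kind4 d L U false xl (xl + 1) (2 * D1 + 1) (2 * D1 + 1)
| LeftLeaf4 xl of U = 1 & L = 1 & d = D1 + i1 + 1 & xl + i1 + 1 = B :
    kind4 d L U true xl (xl + 1) 0 (2 * H)
| RightInner4 e of L = K + 3 & U = K + 3 & e < i2 & d = D2 + e + 1 :
    kind4 d L U false (B + 2 * K + 8 + e) (B + 2 * K + 8 + e + 1) (2 * D2 + 1) (2 * D2 + 1)
| RightLeaf4 of L = K + 3 & U = K + 3 & d = D2 + i2 + 1 :
    kind4 d L U true (B + 2 * K + 8 + i2) (B + 2 * K + 8 + i2 + 1) 0 (2 * H).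

Lemma kind4P d L U lf : admissible4 d L U lf ->
  kind4 d L U lf (left4 d L U lf) (right4 d L U lf) (bottom4 d L U lf) (top4 d L U lf).
Proof.
move=> [[d0 dH L0 LU Uk] [a1 a2 a3] [b1 b2 b3] lfP].
rewrite /left4 /right4 /bottom4 /top4.
case: eqP a1 a2 a3 => [U1 _ /(_ U1) a2 /(_ U1) a3|U1 a1 _ _].
  have L1 : L = 1 by clear -LU L0 U1; lia.
  case: lf a3 {lfP b3} => a3; first by constructor=> //; clear -a3 HB D1i1; lia.
  by apply: (@LeftInner4 _ _ _ _ (d - D1)) => //; clear -dH a2 a3 HB; lia.
case: eqP b1 b2 b3 => [Lk _ /(_ Lk) b2 /(_ Lk) b3|Lk b1 _ _].
  have Uk1 : U = K + 3 by clear -LU Lk Uk; lia.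
  case: lf b3 {lfP} => b3; last by constructor=> //; clear -b2 b3; lia.
  have -> : d - D2.+1 = i2 by clear -b3; lia.
  by constructor.
case: lf lfP => [/(_ isT)[eLU l2 lk]|_]; constructor.
- by [].
- by clear -U1 L0 eLU; lia.
- by clear -Lk Uk LU; lia.
- case: eqP => [e|ne]; [left|right]; first by rewrite l2 //; split=> //; split=> //; clear -HB D1i1; lia.
  by clear -eLU U1 L0 ne; lia.
- case: eqP => [e|ne]; [left|right]; first by rewrite lk.
  by clear -eLU Lk LU Uk ne; lia.
- by clear -U1 L0 LU; lia.
- by clear -Lk Uk LU; lia.
- case: eqP => [L1|L1] /=; last by right; clear -L0 L1; lia.
  have dD : d <= D1 by apply: a1 => //; clear -L0 LU U1; lia.
  by case: eqP => [dD1|dD1]; [left|right; split=> //; clear -dD dD1; lia].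
case: eqP => [Uk1|Uk1] /=; last by right; clear -Uk Uk1; lia.
have dD : d <= D2 by apply: b1 => //; clear -LU Uk Lk; lia.
by case: eqP => [dD2|dD2]; [left|right; split=> //; clear -dD dD2; lia].
Qed.

Definition meet4 d L U lf d' L' U' lf' :=
  [&& left4 d L U lf <= right4 d' L' U' lf', left4 d' L' U' lf' <= right4 d L U lf,
      bottom4 d L U lf <= top4 d' L' U' lf' & bottom4 d' L' U' lf' <= top4 d L U lf].

Lemma meet4_apart d L U lf d' L' U' lf' :
  admissible4 d L U lf -> admissible4 d' L' U' lf' -> U < L' ->
  meet4 d L U lf d' L' U' lf' = [&& lf, lf' & L' == L.+1].
Proof.
move=> ad ad' UL'; rewrite /meet4.
have [[d0 dH L0 LU Uk] _ _ _] := ad; have [[d0' dH' L0' LU' Uk'] _ _ _] := ad'.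
have K' := kind4P ad'; case: (kind4P ad) => *; case: K' => *; clear ad ad';
  apply: and4_eq => *; try split; lia.
Qed.

Lemma meet4_nested d L U lf d' L' U' lf' :
  admissible4 d L U lf -> admissible4 d' L' U' lf' -> d < d' -> L <= L' -> U' <= U -> ~~ lf ->
  meet4 d L U lf d' L' U' lf' = (d' == d.+1).
Proof.
move=> ad ad' dd' LL' UU' nlf; rewrite /meet4.
have [[d0 dH L0 LU Uk] _ _ _] := ad; have [[d0' dH' L0' LU' Uk'] _ _ _] := ad'.
have K' := kind4P ad'; case: (kind4P ad) nlf => // *; case: K' => *; clear ad ad';
  apply: and4_eq => *; try split; lia.
Qed.

Lemma box4_wf d L U lf : admissible4 d L U lf ->
  left4 d L U lf <= right4 d L U lf /\ bottom4 d L U lf <= top4 d L U lf.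
Proof.
move=> ad; have [[d0 dH L0 LU Uk] _ _ _] := ad.
by case: (kind4P ad) => *; clear ad; split; lia.
Qed.

(** The box of the root has its lower corner at the origin, so only the two comparisons with its
    upper ends remain. *)
Lemma meet4_root d L U lf : admissible4 d L U lf -> (d = 1 -> L = 1 /\ U = K + 3) ->
  (left4 d L U lf <= B + 2 * K + 8 + H) && (bottom4 d L U lf <= 2)
  = (d == 1) || lf && ((L == 1) || (L == K + 3)).
Proof.
move=> ad d1; have [[d0 dH L0 LU Uk] _ _ _] := ad.
by case: (kind4P ad) => *; clear ad; apply/idP/idP; lia.
Qed.
End BoxesFour.

(* The boxes for [size c = 3]. Both chains below the branching vertex, which has
   depth [D], run to the left; the shorter one, towards the leaf of index [a],
   runs higher and with half the step, so that the large box of the other leaf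
   avoids it. *)
Section BoxesThree.
Variables a B H D ja jb : nat.

Definition left3 (d L U : nat) (lf : bool) : nat :=
  if L == U then (if lf then 0 else if L == a then B - (d - D) else B - 2 * (d - D))
  else if d == D then B else B + 1.
Definition right3 (d L U : nat) : nat :=
  if L == U then (if L == a then B - (d - D) + 1 else B - 2 * (d - D) + 2) else B + 1.
(** Rows have height 6 to fit both chains strictly inside the rows of the branching vertex. The
    boxes of both leaves contain the origin, hence meet each other and the root. *)
Definition bottom3 (d L U : nat) (lf : bool) : nat :=
  if L == U then (if lf then 0 else if L == a then 6 * D + 2 else 6 * D + 4) else 6 * d.
Definition top3 (d L U : nat) : nat :=
  if L == U then (if L == a then 6 * D + 2 else 6 * D + 4) else 6 * d + 6.

Definition admissible3 (d L U : nat) (lf : bool) : Prop :=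
  [/\ [/\ 0 < d, d < H, 0 < L, L <= U & U <= 2],
      L < U -> d <= D, L = U -> D < d,
      L = U -> L = a -> if lf then d = D + ja + 1 else d <= D + ja
    & L = U -> L <> a -> if lf then d = D + jb + 1 else d <= D + jb] /\ (lf -> L = U).

Hypotheses (a12 : 0 < a <= 2) (HB : 2 * H <= B) (D_gt0 : 0 < D) (Djb : D + jb < H) (jab : ja <= jb).

Inductive kind3 (d L U : nat) : bool -> nat -> nat -> nat -> nat -> Prop :=
| Trunk3 xl of L = 1 & U = 2 & d = D /\ xl = B \/ d < D /\ xl = B + 1 :
    kind3 d L U false xl (B + 1) (6 * d) (6 * d + 6)
| ShortInner3 xl e of L = a & U = a & 0 < e & e <= ja & d = D + e & xl + e = B :
    kind3 d L U false xl (xl + 1) (6 * D + 2) (6 * D + 2)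
| ShortLeaf3 xr of L = a & U = a & d = D + ja + 1 & xr + ja = B :
    kind3 d L U true 0 xr 0 (6 * D + 2)
| LongInner3 xl e of L = U & L <> a & 0 < e & e <= jb & d = D + e & xl + 2 * e = B :
    kind3 d L U false xl (xl + 2) (6 * D + 4) (6 * D + 4)
| LongLeaf3 xr of L = U & L <> a & d = D + jb + 1 & xr + 2 * jb = B :
    kind3 d L U true 0 xr 0 (6 * D + 4).

Lemma kind3P d L U lf : admissible3 d L U lf ->
  kind3 d L U lf (left3 d L U lf) (right3 d L U) (bottom3 d L U lf) (top3 d L U).
Proof.
move=> [[[d0 dH L0 LU U2] a1 a2 a3 a4] lfP].
rewrite /left3 /right3 /bottom3 /top3.
case: eqP a1 a2 a3 a4 lfP => [LU1 _ /(_ LU1) a2 /(_ LU1) a3 /(_ LU1) a4 _|LU1 a1 _ _ _ lfP].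
  case: eqP a3 a4 => [La /(_ La) a3 _|La _ /(_ La) a4].
    have Ua : U = a by rewrite -LU1.
    case: lf a3 => a3; first by constructor=> //; clear -a3 HB Djb jab; lia.
    by apply: (@ShortInner3 _ _ _ _ (d - D)) => //; clear -dH a2 a3 HB; lia.
  case: lf a4 => a4; first by constructor=> //; clear -a4 HB Djb jab; lia.
  by apply: (@LongInner3 _ _ _ _ (d - D)) => //; clear -dH a2 a4 HB; lia.
case: lf lfP => [/(_ isT) //|_].
have dD : d <= D by apply: a1; clear -LU LU1; lia.
constructor; [by clear -L0 LU U2 LU1; lia|by clear -L0 LU U2 LU1; lia|].
by case: eqP => [dD1|dD1]; [left|right; split=> //; clear -dD dD1; lia].
Qed.

Definition meet3 d L U lf d' L' U' lf' :=
  [&& left3 d L U lf <= right3 d' L' U', left3 d' L' U' lf' <= right3 d L U,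
      bottom3 d L U lf <= top3 d' L' U' & bottom3 d' L' U' lf' <= top3 d L U].

Lemma meet3_apart d L U lf d' L' U' lf' :
  admissible3 d L U lf -> admissible3 d' L' U' lf' -> U < L' ->
  meet3 d L U lf d' L' U' lf' = [&& lf, lf' & L' == L.+1].
Proof.
move=> ad ad' UL'; rewrite /meet3.
have [[[d0 dH L0 LU U2] _ _ _ _] _] := ad; have [[[d0' dH' L0' LU' U2'] _ _ _ _] _] := ad'.
have K' := kind3P ad'; case: (kind3P ad) => *; case: K' => *; clear ad ad';
  apply: and4_eq => *; try split; lia.
Qed.

Lemma meet3_nested d L U lf d' L' U' lf' :
  admissible3 d L U lf -> admissible3 d' L' U' lf' -> d < d' -> L <= L' -> U' <= U -> ~~ lf ->
  meet3 d L U lf d' L' U' lf' = (d' == d.+1).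
Proof.
move=> ad ad' dd' LL' UU' nlf; rewrite /meet3.
have [[[d0 dH L0 LU U2] _ _ _ _] _] := ad; have [[[d0' dH' L0' LU' U2'] _ _ _ _] _] := ad'.
have K' := kind3P ad'; case: (kind3P ad) nlf => // *; case: K' => *; clear ad ad';
  apply: and4_eq => *; try split; lia.
Qed.

Lemma box3_wf d L U lf : admissible3 d L U lf ->
  left3 d L U lf <= right3 d L U /\ bottom3 d L U lf <= top3 d L U.
Proof.
move=> ad; have [[[d0 dH L0 LU U2] _ _ _ _] _] := ad.
by case: (kind3P ad) => *; clear ad; split; lia.
Qed.

Lemma meet3_root d L U lf : admissible3 d L U lf -> (d = 1 -> L = 1 /\ U = 2) ->
  (left3 d L U lf <= B + 1) && (bottom3 d L U lf <= 6)
  = (d == 1) || lf && ((L == 1) || (L == 2)).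
Proof.
move=> ad d1; have [[[d0 dH L0 LU U2] _ _ _ _] _] := ad.
by case: (kind3P ad) => *; clear ad; apply/idP/idP; lia.
Qed.
End BoxesThree.

(** * Upper bound *)

Section HalinGraph.
Variables (R : realType) (V : finType) (G T : sgraph V) (c : seq V).
Hypotheses (Gplanar : planar R G) (uc : uniq c) (kc : 3 <= size c).
Hypothesis Cleaves : forall x, (x \in c) = leaf T x.
Hypothesis GTC : forall x y, G x y = T x y || cycle_adj c x y.
Variables (r : V) (par : V -> V) (d : V -> nat).
Hypotheses (rc : r \in c) (r0 : index r c = 0).
Hypotheses (dr : d r = 0) (parr : par r = r).
Hypothesis parP : forall x, x != r -> T x (par x) /\ d x = (d (par x)).+1.
Hypothesis T_par : forall x y, T x y -> (x != r /\ par x = y) \/ (y != r /\ par y = x).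

Notation below v x := (fconnect par x v).
Notation idx x := (index x c).

Lemma root_child : exists y, [/\ y != r, par y = r & forall x, x != r -> below y x].
Proof.
have lr : leaf T r by rewrite -Cleaves.
have /eqP/mem_card1[y Ty] := lr; have Try : T r y by have := Ty y; rewrite !inE eqxx.
have [[]|[yr pyr]] := T_par Try; first by rewrite eqxx.
exists y; split=> // x; move: {2}(d x) (erefl (d x)) => n; elim: n x => [|n IH] x dx xr.
  by have [_] := parP xr; rewrite dx.
have [Tx dpx] := parP xr; have [pxr|pxr] := eqVneq (par x) r.
  rewrite pxr adj_sym in Tx; rewrite (leaf_neighbor lr Tx Try); exact: connect0.
by apply: connect_trans (fconnect1 par x) (IH _ _ pxr); lia.
Qed.

Lemma idx_inj x y : x \in c -> idx x = idx y -> x = y.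
Proof.
move=> xc e; have yc : y \in c by rewrite -index_mem -e index_mem.
by rewrite -(nth_index r xc) e nth_index.
Qed.

Lemma cycle_segment x y : x \in c -> y \in c -> idx x <= idx y ->
  conn_in G (fun z => z \in c /\ idx x <= idx z <= idx y) x y.
Proof.
move=> xc yc; move: {2}(idx y - idx x) (erefl (idx y - idx x)) => n.
elim: n x xc => [|n IH] x xc e xy.
  have -> : x = y by apply: idx_inj => //; lia.
  by apply: conn_in_refl; rewrite leqnn.
have yk : idx y < size c by rewrite index_mem.
have x1c : (idx x).+1 < size c by lia.
pose z := nth r c (idx x).+1; have zc : z \in c by rewrite mem_nth.
have iz : idx z = (idx x).+1 by rewrite index_uniq.
have xz : G x z by rewrite GTC cycle_adjE // iz modn_small // eqxx orbT.
apply: conn_in_step xz _; first by rewrite xc leqnn.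
apply: conn_in_mono (IH z zc _ _); [by []| |lia|lia].
by move=> w [wc]; split=> //; lia.
Qed.

(* Otherwise [x, y, y0] and [b, r, v] are the branch vertices of a subdivided
   K_{3,3} in [G], where [y0] is the child of the root. *)
Lemma crossing_absurd v w x b y : v != r -> ~ below v b -> below v x -> below v y ->
  w != r -> x \in c -> y \in c -> b \in c -> 0 < idx x -> idx x < idx b < idx y -> False.
Proof.
move=> vr nvb vx vy wr xc yc bc x0 xby.
have Gsym : symmetric G by exact: adj_sym.
have TG : subrel T G by move=> s t; rewrite GTC => ->.
have [y0 [y0r py0 y0P]] := root_child.
have br : b != r by apply: contraTneq xby => ->; rewrite r0; clear; lia.
have leaf_v z : below v z -> z \in c -> below z x || below z y -> (z == x) || (z == y).
  move=> vz zc; have zr : z != r.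
    by apply: contra_neq vr => zr; apply: (below_rootN parr); rewrite -zr.
  rewrite Cleaves in zc.
  by case/orP => /(leaf_below dr parr parP zc zr) ->; rewrite eqxx ?orbT.
have vnc : v \notin c.
  apply/negP; rewrite Cleaves => lv.
  have e1 := leaf_below dr parr parP lv vr vx; have e2 := leaf_below dr parr parP lv vr vy.
  by move: xby; rewrite e1 e2; clear; lia.
have nvy0 : ~ below v y0 by move=> vy0; apply: nvb; exact: connect_trans (y0P _ br) vy0.
have nvr : ~ below v r by move/(below_rootN parr) => e; rewrite e eqxx in vr.
have y0nc : y0 \notin c.
  apply/negP; rewrite Cleaves => ly.
  have e1 := leaf_below dr parr parP ly y0r (y0P _ br).
  by have e2 := leaf_below dr parr parP ly y0r (y0P _ vr); apply: nvy0; rewrite -e2 connect0.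
(* The tree paths from [y0] to [b] and to [v] may share a piece, which is harmless as they have a
   common end; the vertex where they part is never named. Each set is described by [c], the subtree
   of [v], [r], [y0] and the index, so disjointness is a finite check. *)
pose A (i : 'I_3) := nth r [:: x; y; y0] i; pose B (i : 'I_3) := nth r [:: b; r; v] i.
pose S (i j : 'I_3) (z : V) : Prop := nth xpred0 (nth [::] [::
  [:: fun z => (z \in c) && (idx x <= idx z <= idx b);
      fun z => (z \in c) && (idx z <= idx x);
      fun z => below v z && ((z \in c) ==> (idx z == idx x))];
  [:: fun z => (z \in c) && (idx b <= idx z <= idx y);
      fun z => (z \in c) && ((idx y <= idx z) || (idx z == 0));
      fun z => below v z && ((z \in c) ==> (idx z == idx y))];
  [:: fun z => [&& ~~ below v z, z != r & (z \in c) ==> (idx z == idx b)];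
      fun z => (z == y0) || (z == r);
      fun z => z \notin c]] i) j z.
apply: (planar_no_K33 (A := A) (B := B) (S := S) Gplanar); last first.
  move=> i j k l z.
  have zr : (z == r) ==> [&& z \in c, idx z == 0 & ~~ below v z].
    by apply/implyP => /eqP ->; rewrite rc r0 eqxx; apply/negP.
  have zy : (z == y0) ==> (z \notin c) && ~~ below v z.
    by apply/implyP => /eqP ->; rewrite y0nc; apply/negP.
  case: i => -[|[|[|//]]] ?; case: k => -[|[|[|//]]] ? // _;
    case: j => -[|[|[|//]]] ?; case: l => -[|[|[|//]]] ? // _; rewrite /S /=;
    move: zr zy; move: (z \in c) (below v z) (z == r) (z == y0) (idx z);
    clear -xby x0 => -[] [] [] [] //= n; lia.
have down u t (P : pred V) : below u t -> (forall z, below u z -> below z t -> P z) ->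
    conn_in G P t u.
  by move=> ut uP; apply: conn_in_mono TG _ (climb dr parr parP ut) => z [uz zt]; exact: uP.
have up u t (P : pred V) : below u t -> (forall z, below u z -> below z t -> P z) ->
    conn_in G P u t.
  by move=> ut uP; apply: conn_in_sym => //; exact: down.
have leaf_le z t : z \in c -> z != r -> below z t -> t = z.
  by rewrite Cleaves => lz zr; exact: leaf_below dr parr parP _ _ lz zr.
have below_neq u z : u != r -> below u z -> z != r.
  by move=> ur uz; apply: contra_neq ur => zr; apply: (below_rootN parr); rewrite -zr.
have seg u t (P : pred V) : u \in c -> t \in c -> idx u <= idx t ->
    (forall z, z \in c -> idx u <= idx z <= idx t -> P z) -> conn_in G P u t.
  move=> uc' tc ut uP.
  by apply: conn_in_mono (cycle_segment uc' tc ut) => // z [zc /uP]; exact.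
have segr u t (P : pred V) : u \in c -> t \in c -> idx u <= idx t ->
    (forall z, z \in c -> idx u <= idx z <= idx t -> P z) -> conn_in G P t u.
  by move=> uc' tc ut uP; apply: conn_in_sym => //; exact: seg.
have [xb by_] := andP xby.
move=> i j; case: i => -[|[|[|//]]] hi; case: j => -[|[|[|//]]] hj; rewrite /S /A /B /=.
- by apply: seg => //; [exact: ltnW|move=> z -> ->].
- by apply: segr => //; [rewrite r0|move=> z -> /andP[_ ->]].
- apply: down vx _ => z vz zx; rewrite vz; apply/implyP => zc.
  by rewrite (leaf_le _ _ zc (below_neq _ _ vr vz) zx).
- by apply: segr => //; [exact: ltnW|move=> z -> ->].
(* From [y], C is followed to its last leaf [e] and then back to [r] by the closing edge. *)
- have k1 : (size c).-1 < size c by rewrite prednK // (leq_trans _ kc).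
  pose e := nth r c (size c).-1; have ec : e \in c by rewrite mem_nth.
  have ie : idx e = (size c).-1 by rewrite index_uniq.
  have er : G e r.
    by rewrite GTC cycle_adjE // ie r0 prednK ?modnn ?eqxx ?orbT // (leq_trans _ kc).
  have ye : idx y <= idx e by rewrite ie -ltnS prednK ?index_mem // (leq_trans _ kc).
  apply: (conn_in_trans (y := e)); first by apply: seg => // z -> /andP[->].
  apply: conn_in_step er _; first by rewrite ec ye.
  by apply: conn_in_refl; rewrite rc r0 orbT.
- apply: down vy _ => z vz zy; rewrite vz; apply/implyP => zc.
  by rewrite (leaf_le _ _ zc (below_neq _ _ vr vz) zy).
- apply: up (y0P _ br) _ => z yz zb; rewrite (below_neq _ _ y0r yz) andTb.
  apply/andP; split; first by apply/negP => vz; apply: nvb; exact: connect_trans zb vz.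
  by apply/implyP => zc; rewrite (leaf_le _ _ zc (below_neq _ _ y0r yz) zb).
- apply: (conn_in_step (y := r)); rewrite ?eqxx //.
    by have [Ty _] := parP y0r; rewrite GTC -py0 Ty.
  by apply: conn_in_refl; rewrite eqxx orbT.
apply: up (y0P _ vr) _ => z yz zv; apply/negP => zc.
by move: vnc; rewrite (leaf_le _ _ zc (below_neq _ _ y0r yz) zv) zc.
Qed.

Lemma leaf_range v : v != r -> exists ab : nat * nat,
  [/\ exists x, [/\ x \in c, x != r, below v x & idx x = ab.1],
     exists x, [/\ x \in c, x != r, below v x & idx x = ab.2]
   & forall x, x \in c -> below v x -> ab.1 <= idx x <= ab.2].
Proof.
move=> vr; have [x0 [lx0 x0r vx0]] := leaf_above dr parr parP T_par vr.
pose P x := (x \in c) && below v x; have Px0 : P x0 by rewrite /P Cleaves lx0.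
have below_neq z : below v z -> z != r.
  by move=> vz; apply: contra_neq vr => zr; apply: (below_rootN parr); rewrite -zr.
case: (arg_minnP (fun x => idx x) Px0) => p Pp minp; have /andP[pc vp] := Pp.
case: (arg_maxnP (fun x => idx x) Px0) => q Pq maxq; have /andP[qc vq] := Pq.
exists (idx p, idx q); split; [by exists p; rewrite below_neq|by exists q; rewrite below_neq|].
move=> x xc vx; have Px : P x by apply/andP.
by apply/andP; split; [exact: minp|exact: maxq].
Qed.

(* [L v] and [U v] are the extreme indices in [c] of the leaves below [v]. *)
Definition coordinates (L U : V -> nat) : Prop :=
  [/\ forall x, x != r -> [/\ 0 < d x, 0 < L x & L x <= U x < size c],
      forall x y, x != r -> y != r -> x != y -> d x = d y -> U x < L y \/ U y < L x,
      forall x y, x != r -> y != r -> d x < d y ->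
        [\/ U x < L y, U y < L x | L x <= L y /\ U y <= U x],
      forall x y, x != r -> y != r ->
        T x y = [&& L x <= U y, L y <= U x & (d x == (d y).+1) || (d y == (d x).+1)]
    & [/\ forall x, x != r -> x \in c -> [/\ L x = idx x, U x = idx x &
           forall y, y != r -> y != x -> L y <= idx x <= U y -> d y < d x],
           forall x, x != r -> T r x = (d x == 1),
           forall x, x != r -> d x = 1 -> L x = 1 /\ U x = (size c).-1
         & exists2 x, x != r & d x = 1]].

Lemma box_coordinates : exists L U, coordinates L U.
Proof.
have range v : exists ab : nat * nat, v != r ->
    [/\ exists x, [/\ x \in c, x != r, below v x & idx x = ab.1],
       exists x, [/\ x \in c, x != r, below v x & idx x = ab.2]
     & forall x, x \in c -> below v x -> ab.1 <= idx x <= ab.2].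
  have [->|vr] := eqVneq v r; first by exists (0, 0).
  by have [ab abP] := leaf_range vr; exists ab.
have [LU LUP] := choice range; exists (fun v => (LU v).1), (fun v => (LU v).2).
have depth_le v x : below v x -> d v <= d x by case/(below_depth dr parr parP).
have depth_eq v x : below v x -> d v = d x -> v = x by case/(below_depth dr parr parP).
have idx_gt0 x : x \in c -> x != r -> 0 < idx x.
  by move=> xc xr; rewrite lt0n; apply: contra_neq xr => x0; apply: idx_inj; rewrite ?r0.
have idx_lt x : x \in c -> idx x < size c by rewrite index_mem.
have incomp x y : x != r -> y != r -> ~ below x y -> ~ below y x ->
    (LU x).2 < (LU y).1 \/ (LU y).2 < (LU x).1.
  move=> xr yr nxy nyx.
  have [[p [pc pr xp ip]] [q [qc qr xq iq]] _] := LUP x xr.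
  have [[s [sc sr ys is_]] [t [tc tr yt it]] _] := LUP y yr.
  have apart z w : z \in c -> below x z -> below y w -> idx z != idx w.
    move=> zc xz yw; apply/eqP => /(idx_inj zc) e; subst w.
    by case: (below_chain xz yw).
  have ps := apart p s pc xp ys; have pt := apart p t pc xp yt; have qs := apart q s qc xq ys.
  (* If the ranges meet, the larger of their left ends lies strictly between the extreme leaves of
     the other vertex, which is the forbidden pattern. *)
  apply/orP; apply: contraT; rewrite negb_or -!leqNgt -ip -iq -is_ -it => /andP[sq pt'].
  case: (ltnP (idx p) (idx s)) => h; exfalso.
    apply: (crossing_absurd (v := x) (w := y) (x := p) (b := s) (y := q)) => //.
    - by move=> xs; case: (below_chain xs ys).
    - exact: idx_gt0.
    - by rewrite h ltn_neqAle eq_sym qs sq.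
  apply: (crossing_absurd (v := y) (w := x) (x := s) (b := p) (y := t)) => //.
  - by move=> yp; case: (below_chain xp yp).
  - exact: idx_gt0.
  - by rewrite !ltn_neqAle eq_sym ps h pt pt'.
have nested x y : x != r -> y != r -> below x y ->
    (LU x).1 <= (LU y).1 /\ (LU y).2 <= (LU x).2.
  move=> xr yr xy; have [_ _ ltx] := LUP x xr.
  have [[s [sc sr ys <-]] [t [tc tr yt <-]] _] := LUP y yr.
  have := ltx s sc (connect_trans ys xy); have := ltx t tc (connect_trans yt xy).
  by move=> /andP[_ ->] /andP[-> _].
have LUle x : x != r -> (LU x).1 <= (LU x).2.
  by move=> xr; have [[s [sc sr xs <-]] _ lt_x] := LUP x xr; have /andP[_ ->] := lt_x s sc xs.
have trich x y : x != r -> y != r -> [\/ below x y, below y x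
    | (LU x).2 < (LU y).1 \/ (LU y).2 < (LU x).1].
  move=> xr yr; have [xy|/negP nxy] := boolP (below x y); first by constructor 1.
  have [yx|/negP nyx] := boolP (below y x); first by constructor 2.
  by constructor 3; exact: incomp.
have child x y : x != r -> below x y -> d y = (d x).+1 -> T x y.
  move=> xr xy dxy; have nxy : x != y by apply/eqP => e; move: dxy; rewrite e; lia.
  have [yr xpy] := below_step parr xy nxy; have [Ty dpy] := parP yr.
  have e : x = par y by apply: depth_eq xpy _; apply: succn_inj; rewrite -dpy.
  by rewrite e adj_sym.
have [y0 [y0r py0 y0P]] := root_child.
have dy0 : d y0 = 1 by have [_ ->] := parP y0r; rewrite py0 dr.
split.
- move=> x xr; have [_ dx] := parP xr; rewrite dx; split=> //.
    by have [[s [sc sr xs <-]] _ _] := LUP x xr; exact: idx_gt0.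
  rewrite LUle //=; have [_ [s [sc sr xs <-]] _] := LUP x xr; exact: idx_lt.
- move=> x y xr yr nxy dxy; case: (trich x y xr yr) => // [xy|yx]; exfalso.
    by move/eqP: nxy; apply; exact: depth_eq.
  by move/eqP: nxy; apply; apply/esym/depth_eq.
- move=> x y xr yr dxy; case: (trich x y xr yr) => [xy|yx|[H|H]].
  + by constructor 3; exact: nested.
  + by have := depth_le _ _ yx; rewrite leqNgt dxy.
  + by constructor 1.
  + by constructor 2.
- move=> x y xr yr; apply/idP/idP.
    move=> /T_par[[_ pxy]|[_ pyx]].
      have [_ dx] := parP xr; have yx : below y x by rewrite -pxy fconnect1.
      have [h1 h2] := nested y x yr xr yx; have := LUle x xr; rewrite dx pxy eqxx /= andbT => h3.
      by rewrite (leq_trans h3 h2) (leq_trans h1 h3).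
    have [_ dy] := parP yr; have xy : below x y by rewrite -pyx fconnect1.
    have [h1 h2] := nested x y xr yr xy; have := LUle y yr; rewrite dy pyx eqxx orbT andbT => h3.
    by rewrite (leq_trans h1 h3) (leq_trans h3 h2).
  case/and3P=> h1 h2 /orP[/eqP dxy|/eqP dxy]; case: (trich x y xr yr) => [xy|yx|[]]; rewrite ?[_ < _]ltnNge ?h1 ?h2 //.
  + by have := depth_le _ _ xy; rewrite dxy ltnn.
  + by rewrite adj_sym; exact: child.
  + exact: child.
  + by have := depth_le _ _ yx; rewrite dxy ltnn.
split.
- move=> x xr xc; have lx : leaf T x by rewrite -Cleaves.
  have only s : below x s -> s = x by exact: leaf_below dr parr parP _ _ lx xr.
  have [[s [_ _ /only -> e1]] [t [_ _ /only -> e2]] _] := LUP x xr; split=> // y yr yx.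
  rewrite {1}e1 e2 => /andP[h1 h2]; case: (trich x y xr yr) => [xy|yx'|[]].
  + by rewrite (only y xy) eqxx in yx.
  + rewrite ltn_neqAle depth_le // andbT; apply: contra_neq yx; exact: depth_eq.
  + by rewrite ltnNge -e2 e1 h1.
  + by rewrite ltnNge -e1 e2 h2.
- move=> x xr; rewrite (T_parE parP T_par) eqxx xr /=; have [_ dx] := parP xr.
  rewrite dx eqSS; apply/eqP/eqP => [->//|dpx]; apply/eqP; apply: contraT => pxr.
  by have [_] := parP pxr; rewrite dpx.
- move=> x xr dx; have xy0 : below y0 x by exact: y0P.
  have {xy0} <- : y0 = x by apply: depth_eq => //; rewrite dy0 dx.
  have leaf_i i : 0 < i < size c -> (LU y0).1 <= i <= (LU y0).2.
    move=> /andP[i0 ik]; have [_ _] := LUP y0 y0r.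
    have ii : idx (nth r c i) = i by rewrite index_uniq.
    have ir : nth r c i != r by apply/eqP => e; move: ii; rewrite e r0 => e0; rewrite -e0 in i0.
    by move=> /(_ (nth r c i)); rewrite ii; apply; [exact: mem_nth|exact: y0P].
  have k0 : 0 < size c by exact: leq_trans kc.
  have k1 : 1 < size c by exact: leq_trans kc.
  have kk : 0 < (size c).-1 < size c by clear -kc; lia.
  have := leaf_i 1 k1; have := leaf_i _ kk.
  have [[s [sc sr _ <-]] [t [tc tr _ <-]] _] := LUP y0 y0r.
  have := idx_gt0 s sc sr; have := idx_lt t tc.
  move=> h1 h2 /andP[_ h3] /andP[h4 _]; split; apply/eqP; rewrite eqn_leq ?h4 ?h2 ?h3 //.
  by rewrite -ltnS prednK // h1.
by exists y0.
Qed.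

(** The part common to both layouts: two vertices other than the root have disjoint or nested
    ranges, so a layout has to be checked in these two cases and against the root. *)
Lemma boxes_representable (L U l u b t : V -> nat) (xmax ymax : nat) :
  coordinates L U ->
  (forall x, x != r -> l x <= u x /\ b x <= t x) ->
  (forall x y, x != r -> y != r -> U x < L y ->
    [&& l x <= u y, l y <= u x, b x <= t y & b y <= t x] =
    [&& x \in c, y \in c & L y == (L x).+1]) ->
  (forall x y, x != r -> y != r -> d x < d y -> L x <= L y -> U y <= U x -> x \notin c ->
    [&& l x <= u y, l y <= u x, b x <= t y & b y <= t x] = (d y == (d x).+1)) ->
  (forall x, x != r -> (l x <= xmax) && (b x <= ymax) =
    (d x == 1) || (x \in c) && ((L x == 1) || (L x == (size c).-1))) ->
  box_representable R G 2.
Proof.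
move=> [range same_d nest TE [leafP rootP root1 _]] wf apart nested root_meet.
have idxU x : x != r -> x \in c -> L x = idx x /\ U x = idx x.
  by move=> xr xc; have [] := leafP x xr xc.
have caE x y := @cycle_adjE V c x y uc.
have ca_notin x y : (x \notin c) || (y \notin c) -> cycle_adj c x y = false.
  by rewrite /cycle_adj /=; case: (x \in c); case: (y \in c).
have G_apart x y : x != r -> y != r -> U x < L y ->
    G x y = [&& x \in c, y \in c & L y == (L x).+1].
  move=> xr yr xy; rewrite GTC TE // [L y <= _]leqNgt xy andbF /=.
  case xc: (x \in c); last by rewrite ca_notin // xc.
  case yc: (y \in c); last by rewrite ca_notin // yc orbT.
  have [[eL eU] [eL' eU']] := (idxU x xr xc, idxU y yr yc).
  rewrite caE // eL eL' /=; move: xy; rewrite eU eL' => xy.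
  have [_ y0] := range y yr; rewrite eL' eU' leqnn /= => yk.
  have [_ x0] := range x xr; rewrite eL => _.
  (* The closing edge of C ends at the root, of index 0, so other leaves are adjacent along C only
     if their indices are consecutive. *)
  rewrite [(idx x).+1 %% _]modn_small; last by exact: leq_ltn_trans yk.
  case: eqP => //= _; apply/negbTE; move: yk; rewrite leq_eqVlt => /orP[/eqP ->|yk].
    by rewrite modnn -lt0n -eL.
  by rewrite modn_small //; clear -xy; lia.
have G_nested x y : x != r -> y != r -> d x < d y -> L x <= L y -> U y <= U x ->
    x \notin c /\ G x y = (d y == (d x).+1).
  move=> xr yr dxy LL UU; have [_ _ /andP[LUy _]] := range y yr.
  have xnc : x \notin c.
    apply/negP => xc; have [eL eU xP] := leafP x xr xc.
    have yx : y != x by apply/eqP => e; move: dxy; rewrite e ltnn.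
    have yx_meet : L y <= idx x <= U y by clear -LL UU LUy eL eU; lia.
    by have := xP y yr yx yx_meet; rewrite ltnNge (ltnW dxy).
  rewrite GTC TE // ca_notin ?xnc // orbF; split=> //.
  by clear -LL UU LUy dxy; lia.
have G_root x : x != r -> G r x =
    (d x == 1) || (x \in c) && ((L x == 1) || (L x == (size c).-1)).
  move=> xr; rewrite GTC rootP //; congr (_ || _).
  case xc: (x \in c); last by rewrite ca_notin // xc orbT.
  have [eL _] := idxU x xr xc; rewrite caE // r0 eL modn_small /=; last exact: leq_trans kc.
  congr (_ || _); have xk : idx x < size c by rewrite index_mem.
  have [e|ne] := eqVneq (idx x).+1 (size c).
    by rewrite e modnn eqxx; clear -e; lia.
  rewrite modn_small; last by rewrite ltn_neqAle ne xk.
  by clear -ne kc; lia.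
pose X0 v := if v == r then 0 else l v; pose X1 v := if v == r then xmax else u v.
pose Y0 v := if v == r then 0 else b v; pose Y1 v := if v == r then ymax else t v.
apply: (@nat_box_representable R V G X0 X1 Y0 Y1).
- by move=> v; rewrite /X0 /X1; case: eqVneq => // vr; have [] := wf v vr.
- by move=> v; rewrite /Y0 /Y1; case: eqVneq => // vr; have [] := wf v vr.
have swap (p q s w : bool) : [&& p, q, s & w] = [&& q, p, w & s].
  by case: p; case: q; case: s; case: w.
move=> x y xy; rewrite /X0 /X1 /Y0 /Y1.
case: (eqVneq x r) xy => [-> ry|xr xy].
  have yr : y != r by rewrite eq_sym.
  by rewrite (negbTE yr) G_root // -root_meet.
case: (eqVneq y r) => [->|yr].
  by rewrite adj_sym G_root // -root_meet //= andbT.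
case: (ltngtP (d x) (d y)) => [dxy|dyx|e].
- case: (nest x y xr yr dxy) => [h|h|[h1 h2]].
  + by rewrite G_apart // apart.
  + by rewrite adj_sym G_apart // -apart // swap.
  + by have [xnc ->] := G_nested x y xr yr dxy h1 h2; rewrite nested.
- case: (nest y x yr xr dyx) => [h|h|[h1 h2]].
  + by rewrite adj_sym G_apart // -apart // swap.
  + by rewrite G_apart // apart.
  + by have [ync e] := G_nested y x yr xr dyx h1 h2; rewrite adj_sym e -nested // swap.
case: (same_d x y xr yr xy e) => h; first by rewrite G_apart // apart.
by rewrite adj_sym G_apart // -apart // swap.
Qed.

Lemma deepest (P : pred V) x : P x -> exists2 u, P u & forall y, P y -> d y <= d u.
Proof. by move=> Px; case: (arg_maxnP d Px) => u Pu max_u; exists u. Qed.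

Lemma halin_box_representable : box_representable R G 2.
Proof.
have [L [U LU]] := box_coordinates.
have [range same_d nest TE [leafP rootP root1 [y0 y0r dy0]]] := LU.
have [Ly0 Uy0] := root1 y0 y0r dy0.
pose H := (\max_x d x).+1; have dH x : d x < H by rewrite ltnS; exact: leq_bigmax.
have leaf_at i : 0 < i < size c -> exists x, [/\ x \in c, x != r & idx x = i].
  move=> /andP[i0 ik]; exists (nth r c i); have ii : idx (nth r c i) = i by rewrite index_uniq.
  by split=> //; [exact: mem_nth|apply: contraTneq i0 => e; rewrite -ii e r0].
have [l1 [l1c l1r il1]] : exists x, [/\ x \in c, x != r & idx x = 1].
  by apply: leaf_at; clear -kc; lia.
have [l2 [l2c l2r il2]] : exists x, [/\ x \in c, x != r & idx x = (size c).-1].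
  by apply: leaf_at; clear -kc; lia.
have idxLU x : x != r -> x \in c -> L x = idx x /\ U x = idx x.
  by move=> xr xc; have [] := leafP x xr xc.
have [u1 /and3P[u1r /eqP Lu1 Uu1] max_u1] :
    exists2 u, [&& u != r, L u == 1 & 1 < U u] &
      forall y, [&& y != r, L y == 1 & 1 < U y] -> d y <= d u.
  by apply: (deepest (x := y0)); rewrite y0r Ly0 Uy0; clear -kc; lia.
have [u2 /and3P[u2r /eqP Uu2 Lu2] max_u2] :
    exists2 u, [&& u != r, U u == (size c).-1 & L u < (size c).-1] &
      forall y, [&& y != r, U y == (size c).-1 & L y < (size c).-1] -> d y <= d u.
  by apply: (deepest (x := y0)); rewrite y0r Ly0 Uy0 eqxx; clear -kc; lia.
have below_u1 x : x != r -> U x = 1 -> d u1 < d x.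
  move=> xr Ux; have [_ Lx /andP[LUx _]] := range x xr.
  have xu1 : x != u1 by apply: contraTneq Uu1 => <-; rewrite Ux.
  have [dx|dx|e] := ltngtP (d x) (d u1) => //.
    by case: (nest x u1 xr u1r dx); rewrite ?Lu1 ?Ux; clear -Lx LUx Uu1 Ux; lia.
  by case: (same_d x u1 xr u1r xu1 e); rewrite ?Lu1 ?Ux; clear -Lx LUx Uu1 Ux; lia.
have below_u2 x : x != r -> L x = (size c).-1 -> d u2 < d x.
  move=> xr Lx; have [_ _ /andP[LUx Ux]] := range x xr.
  have xu2 : x != u2 by apply: contraTneq Lu2 => <-; rewrite Lx ltnn.
  have [dx|dx|e] := ltngtP (d x) (d u2) => //.
    by case: (nest x u2 xr u2r dx); clear -Lx LUx Ux Uu2 Lu2; lia.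
  by case: (same_d x u2 xr u2r xu2 e); clear -Lx LUx Ux Uu2 Lu2; lia.
have chain1 x : x != r -> U x = 1 -> if x \in c then d x = d l1 else d x < d l1.
  move=> xr Ux; have [_ Lx /andP[LUx _]] := range x xr.
  case xc: (x \in c).
    have [eL eU] := idxLU x xr xc.
    by have -> : x = l1 by apply: idx_inj => //; rewrite il1 -eU.
  have [_ _ l1P] := leafP l1 l1r l1c; apply: l1P => //.
    by apply: contraFneq xc => ->.
  by rewrite il1 Ux (leq_trans LUx) // Ux.
have chain2 x : x != r -> L x = (size c).-1 -> if x \in c then d x = d l2 else d x < d l2.
  move=> xr Lx; have [_ _ /andP[LUx Ux]] := range x xr.
  case xc: (x \in c).
    have [eL eU] := idxLU x xr xc.
    by have -> : x = l2 by apply: idx_inj => //; rewrite il2 -eL.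
  have [_ _ l2P] := leafP l2 l2r l2c; apply: l2P => //.
    by apply: contraFneq xc => ->.
  by rewrite il2 -Lx leqnn.
have Ul1 : U l1 = 1 by have [_ ->] := idxLU l1 l1r l1c.
have Ll2 : L l2 = (size c).-1 by have [-> _] := idxLU l2 l2r l2c.
have Dl1 := below_u1 l1 l1r Ul1; have Dl2 := below_u2 l2 l2r Ll2.
have [D1_gt0 _ _] := range u1 u1r; have [D2_gt0 _ _] := range u2 u2r.
(* [i1] and [i2] count the inner vertices strictly between [u1] and [l1], and between [u2] and
   [l2]. *)
have [i1 di1] : exists i, d l1 = d u1 + i + 1 by exists (d l1 - d u1 - 1); clear -Dl1; lia.
have [i2 di2] : exists i, d l2 = d u2 + i + 1 by exists (d l2 - d u2 - 1); clear -Dl2; lia.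
have Hl1 := dH l1; have Hl2 := dH l2.
have [k3|k4] : size c = 3 \/ exists K, size c = K + 4.
  move: kc; rewrite leq_eqVlt => /orP[/eqP <-|k4]; [by left|right].
  by exists (size c - 4); rewrite subnK.
  (* With only the indices 1 and 2 available, [u1] and [u2] both have the range from 1 to 2, and
     each is deepest with it. *)
  have D12 : d u2 = d u1.
    apply/eqP; rewrite eqn_leq max_u1 ?max_u2 //.
      by rewrite u1r k3 Lu1; have [_ _] := range u1 u1r; rewrite k3; clear -Uu1; lia.
    by rewrite u2r Uu2; have [_ L0 _] := range u2 u2r; move: Lu2; rewrite k3; clear -L0; lia.
  have k2 : (size c).-1 = 2 by rewrite k3.
  rewrite k2 in below_u2 chain2; rewrite D12 in below_u2 di2 Dl2.
  have LU2 x : x != r -> [/\ 0 < L x, L x <= U x & U x <= 2].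
    by move=> xr; have [_ L0 /andP[h1]] := range x xr; rewrite k3.
  have inner x : x != r -> L x < U x -> d x <= d u1.
    move=> xr LUx; apply: max_u1; rewrite xr /=; have [h1 h2 h3] := LU2 x xr.
    by clear -LUx h1 h2 h3; lia.
  have outer x : x != r -> L x = U x -> d u1 < d x.
    move=> xr LUx; have [h1 h2 h3] := LU2 x xr.
    have [Ux|Lx] : U x = 1 \/ L x = 2 by clear -LUx h1 h2 h3; lia.
      exact: below_u1.
    exact: below_u2.
  have leafLU x : x != r -> x \in c -> L x = U x by move=> xr /(idxLU x xr)[-> ->].
  rewrite di1 di2 in chain1 chain2 Hl1 Hl2.
  have [a [ja [jb [a12 jab Hjb adm]]]] : exists a ja jb, [/\ 0 < a <= 2, ja <= jb, d u1 + jb < H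
      & forall x, x != r -> admissible3 a H (d u1) ja jb (d x) (L x) (U x) (x \in c)].
    have sub_if i x : (if x \in c then d x = d u1 + i + 1 else d x < d u1 + i + 1) ->
        if x \in c then d x = d u1 + i + 1 else d x <= d u1 + i.
      by case: ifP => // _; clear; lia.
    have [i12|i21] := leqP i1 i2; [exists 1, i1, i2|exists 2, i2, i1]; split=> //;
      try (by clear -Hl1 Hl2; lia); try exact: ltnW.
      move=> x xr; have [d0 _ _] := range x xr; have [h1 h2 h3] := LU2 x xr.
      split; last exact: leafLU; split=> //; [exact: inner|exact: outer| |].
        by move=> e1 e2; apply/sub_if/chain1; rewrite // -e1.
      move=> e1 e2; apply/sub_if/chain2 => //; clear -h1 h2 h3 e1 e2; lia.
    move=> x xr; have [d0 _ _] := range x xr; have [h1 h2 h3] := LU2 x xr.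
    split; last exact: leafLU; split=> //; [exact: inner|exact: outer| |].
      by move=> e1 e2; apply/sub_if/chain2; rewrite // -e1.
    move=> e1 e2; apply/sub_if/chain1 => //; clear -h1 h2 h3 e1 e2; lia.
  (* [B] is [2 * H] here because the longer chain moves left by 2 per vertex; for longer cycles [B]
     is [H]. *)
  apply: (@boxes_representable L U
    (fun v => left3 a (2 * H) (d u1) (d v) (L v) (U v) (v \in c))
    (fun v => right3 a (2 * H) (d u1) (d v) (L v) (U v))
    (fun v => bottom3 a (d u1) (d v) (L v) (U v) (v \in c))
    (fun v => top3 a (d u1) (d v) (L v) (U v)) (2 * H + 1) 6) => //.
  + by move=> x /adm; exact: box3_wf.
  + by move=> x y /adm ax /adm ay; exact: meet3_apart ax ay.
  + by move=> x y /adm ax /adm ay; exact: meet3_nested ax ay.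
  move=> x xr; rewrite k2; apply: meet3_root (adm x xr) _ => //.
  by move=> dx; rewrite -k2; exact: root1.
have [K kK] := k4; have k1 : (size c).-1 = K + 3 by rewrite kK; clear; lia.
rewrite k1 in max_u2 below_u2 chain2 Uu2 Lu2.
have adm x : x != r -> admissible4 K H (d u1) (d u2) i1 i2 (d x) (L x) (U x) (x \in c).
  move=> xr; have [dx Lx /andP[LUx Ux]] := range x xr.
  split.
  - by split=> //; rewrite kK in Ux; clear -Ux; lia.
  - split; first by move=> Lx1 Ux1; apply: max_u1; rewrite xr Lx1 eqxx.
      exact: below_u1.
    move=> Ux1; have := chain1 x xr Ux1; rewrite di1; case: ifP => // _; clear; lia.
  - split; first by move=> Ux1 Lx1; apply: max_u2; rewrite xr Ux1 eqxx.
      exact: below_u2.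
    move=> Lx1; have := chain2 x xr Lx1; rewrite di2; case: ifP => // _; clear; lia.
  move=> xc; have [eL eU xP] := leafP x xr xc; split; first by rewrite eL eU.
    move=> Lx2; apply: xP => //; first by apply/eqP => e; move: Lx2; rewrite -e Lu1.
    by rewrite Lu1 -eL Lx2.
  move=> Lx2; apply: xP => //; first apply/eqP => e.
    have Ux3 : U x = K + 3 by rewrite -e.
    by clear -Ux3 Lx2 eL eU; lia.
  rewrite Uu2 -eL Lx2; clear -Lu2; lia.
rewrite di1 di2 in Hl1 Hl2.
have D1i1 : d u1 + i1 < H by clear -Hl1; lia.
have D2i2 : d u2 + i2 < H by clear -Hl2; lia.
apply: (@boxes_representable L U
  (fun v => left4 K H (d u1) (d u2) i1 (d v) (L v) (U v) (v \in c))
  (fun v => right4 K H (d u1) (d u2) i2 (d v) (L v) (U v) (v \in c))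
  (fun v => bottom4 K (d u1) (d u2) (d v) (L v) (U v) (v \in c))
  (fun v => top4 K H (d u1) (d u2) (d v) (L v) (U v) (v \in c)) (H + 2 * K + 8 + H) 2) => //.
- by move=> x /adm; exact: box4_wf.
- by move=> x y /adm ax /adm ay; exact: meet4_apart ax ay.
- by move=> x y /adm ax /adm ay; exact: meet4_nested ax ay.
move=> x xr; rewrite k1; apply: meet4_root (adm x xr) _ => //.
by move=> dx; rewrite -k1; exact: root1.
Qed.
End HalinGraph.

(** * Lower bound *)

(* Both neighbours of the interval with the smallest right end contain that end. *)
Lemma not_interval_graph (R : realType) (V : finType) (G : sgraph V) (S : pred V) x0 : S x0 ->
  (forall x, S x -> exists y z, [/\ S y /\ S z, G x y, G x z, y != z & ~~ G y z]) ->
  ~ box_representable R G 1.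
Proof.
move=> Sx0 nbrs [B [boxB GE]].
have ends v : exists ab : R * R, (ab.1 <= ab.2)%R /\
    forall p : 'I_1 -> R, B v p <-> (ab.1 <= p 0%R <= ab.2)%R.
  have [a [b [ab Bv]]] := boxB v; exists (a 0%R, b 0%R); split=> [|p]; first exact: ab.
  rewrite Bv /=; split=> [/(_ 0%R)|pab i]; rewrite in_itv //=.
  by rewrite !(ord1 i).
have [ab abP] := choice ends.
case: (Order.TotalTheory.arg_minP (fun v => (ab v).2) Sx0) => x Sx min_x.
have [y [z [[Sy Sz] xy xz yz /negP]]] := nbrs x Sx; apply; apply/(GE y z yz).
have meets w : S w -> G x w -> B w (fun=> (ab x).2).
  move=> Sw xw; have xw' : x != w by apply: contraTneq xw => ->; rewrite adj_irr.
  have /(GE x w xw')[p [/= /(proj2 (abP x)) /andP[_ px] /(proj2 (abP w)) /andP[wp _]]] := xw.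
  by apply/(proj2 (abP w)); rewrite (le_trans wp px) min_x.
by exists (fun=> (ab x).2); split; exact: meets.
Qed.

Section LowerBound.
Variables (V : finType) (G T : sgraph V) (c : seq V).
Hypotheses (Ttree : is_tree T) (uc : uniq c) (kc : 3 <= size c).
Hypothesis Cleaves : forall x, (x \in c) = leaf T x.
Hypothesis GTC : forall x y, G x y = T x y || cycle_adj c x y.
Hypothesis GnotK4 : ~ isomorphic G (complete 'I_4).
Notation idx x := (index x c).

Lemma closed_full (P : pred V) x : P x -> (forall y z, P y -> T y z -> P z) -> forall y, P y.
Proof.
move=> Px closedP y; have [_ conT _] := Ttree; have /connectP[p xp ->] := conT x y.
elim: p x Px xp => //= z p IH x Px /andP[xz zp]; exact: IH (closedP _ _ Px xz) zp.
Qed.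

(** Two adjacent leaves form a connected component of [T], hence all of it, but there are at least
    three leaves. So [T] adds no chord to C. *)
Lemma leaves_nonadjacent x y : x \in c -> y \in c -> T x y = false.
Proof.
rewrite !Cleaves => lx ly; apply/negP => xy.
have all_xy : forall z, z \in [:: x; y].
  apply: (closed_full (x := x)); first by rewrite mem_head.
  move=> z w; rewrite !inE => /orP[/eqP ->|/eqP ->] zw.
    by rewrite (leaf_neighbor lx zw xy) eqxx orbT.
  by rewrite adj_sym in xy; rewrite (leaf_neighbor ly zw xy) eqxx.
by have := uniq_leq_size uc (fun z _ => all_xy z); rewrite leqNgt kc.
Qed.

Lemma cyclic_succE i j : i < size c -> (j == i.+1 %% size c) =
  if i.+1 == size c then j == 0 else j == i.+1.
Proof.
move=> ik; case: (i.+1 =P size c) => [->|ne]; first by rewrite modnn.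
by rewrite modn_small // ltn_neqAle; apply/andP; split=> //; apply/eqP.
Qed.

Lemma G_leaves x y : x \in c -> y \in c -> G x y =
  (if (idx x).+1 == size c then idx y == 0 else idx y == (idx x).+1) ||
  (if (idx y).+1 == size c then idx x == 0 else idx x == (idx y).+1).
Proof.
move=> xc yc; rewrite GTC leaves_nonadjacent //= cycle_adjE //.
by rewrite !cyclic_succE ?index_mem.
Qed.

Lemma nth_leaf i : i < size c -> exists x, x \in c /\ idx x = i.
Proof.
move=> ik; case: c uc ik => // x0 s us ik; exists (nth x0 (x0 :: s) i).
by rewrite mem_nth // index_uniq.
Qed.

Lemma cycle_chords x : 4 <= size c -> x \in c ->
  exists y z, [/\ y \in c /\ z \in c, G x y, G x z, y != z & ~~ G y z].
Proof.
move=> k4 xc; have xk : idx x < size c by rewrite index_mem.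
have [y [yc iy]] : exists y, y \in c /\ idx y = if (idx x).+1 == size c then 0 else (idx x).+1.
  by apply: nth_leaf; clear -k4 xk; case: eqP; lia.
have [z [zc iz]] : exists z, z \in c /\ idx z = if idx x == 0 then (size c).-1 else (idx x).-1.
  by apply: nth_leaf; clear -k4 xk; case: eqP; lia.
exists y, z; rewrite !G_leaves //; split=> //; clear -k4 xk iy iz.
- by move: iy; do !case: eqP; lia.
- by move: iz; do !case: eqP; lia.
- by apply/eqP => e; move: iy iz; rewrite e; do !case: eqP; lia.
by move: iy iz; do !case: eqP; lia.
Qed.

Lemma G_leaves3 x y : size c = 3 -> x \in c -> y \in c -> x != y -> G x y.
Proof.
move=> k3 xc yc xy; rewrite G_leaves // k3.
have := index_mem x c; have := index_mem y c; rewrite xc yc k3.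
have : idx x != idx y by apply: contra_neq xy; exact: index_inj.
by clear; do !case: eqP; lia.
Qed.

(** [T] is then a star with centre [u] and three leaves, to which C adds the triangle on the
    leaves. *)
Lemma K4_of_star u : size c = 3 -> u \notin c -> (forall w, T u w -> w \in c) ->
  isomorphic G (complete 'I_4).
Proof.
move=> k3 uc' star.
have full w : (w == u) || T u w.
  move: w; apply: (closed_full (x := u)); first by rewrite eqxx.
  move=> y z /orP[/eqP -> -> //|uy yz]; first by rewrite orbT.
  have := star y uy; rewrite Cleaves => ly; rewrite adj_sym in uy.
  by rewrite (leaf_neighbor ly yz uy) eqxx.
have full_mem w : w \in u :: c.
  by rewrite inE; case/orP: (full w) => [->//|/star ->]; rewrite orbT.
have us : uniq (u :: c) by rewrite /= uc'.
pose f w : 'I_4 := inord (index w (u :: c)).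
have fE w : f w = index w (u :: c) :> nat.
  by rewrite inordK // -[4]/(3.+1) -k3 -[(size c).+1]/(size (u :: c)) index_mem.
exists f; split.
  exists (fun i : 'I_4 => nth u (u :: c) i) => [w|i]; first by rewrite fE nth_index.
  by apply: val_inj; rewrite /= fE index_uniq //= k3.
have fI : injective f by move=> x y /(congr1 val); rewrite /= !fE; exact: index_inj.
move=> x y; rewrite /= (inj_eq fI).
have [->|xy] := eqVneq x y; first by rewrite adj_irr.
have := full x; have := full y; have [xu|xu] := eqVneq x u; have [yu|yu] := eqVneq y u => //=.
- by rewrite xu yu eqxx in xy.
- by move=> uy _; rewrite xu GTC uy.
- by move=> _ ux; rewrite yu GTC adj_sym ux.
by move=> /star yc /star xc; rewrite G_leaves3.
Qed.

Lemma other_neighbor v y : v \notin c -> T v y -> exists2 z, T v z & z != y.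
Proof.
move=> vc vy; apply: contrapT => H; move/negP: vc; apply.
rewrite Cleaves /leaf /degree -(card1 y); apply/eqP/eq_card => z; rewrite !inE.
apply/idP/eqP => [vz|-> //]; apply: contrapT => /eqP zy; apply: H; by exists z.
Qed.

Lemma no_triangle x y z : T x y -> T y z -> T x z = false.
Proof.
move=> xy yz; apply/negP => xz; have [_ _ acT] := Ttree.
have neq u w : T u w -> u != w by move=> uw; apply: contraTneq uw => ->; rewrite adj_irr.
have /acT : ucycle T [:: x; y; z].
  by rewrite /ucycle /= xy yz adj_sym xz !inE negb_or !neq.
by [].
Qed.

(** Since [T] is not a star, every inner vertex has an inner neighbour. It settles an inner [v]
    together with any other neighbour, as [T] has no triangle. For a leaf [v], its tree neighbour
    and a leaf not attached to that neighbour are taken. *)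
Lemma no_simplicial_vertex v : size c = 3 ->
  exists y z, [/\ G v y, G v z, y != z & ~~ G y z].
Proof.
move=> k3.
have TG x y : T x y -> G x y by rewrite GTC => ->.
have inner_nbr u : u \notin c -> exists2 w, T u w & w \notin c.
  move=> unc; apply: contrapT => star; case: GnotK4; apply: (K4_of_star k3 unc) => w uw.
  by apply: contrapT => /negP wnc; apply: star; exists w.
have not_cycle x y : (x \notin c) || (y \notin c) -> cycle_adj c x y = false.
  by rewrite /cycle_adj /=; case: (x \in c); case: (y \in c).
have [vc|vnc] := boolP (v \in c); last first.
  have [w vw wnc] := inner_nbr v vnc; have [z vz zw] := other_neighbor vnc vw.
  exists w, z; split; [exact: TG|exact: TG|by rewrite eq_sym|].
  rewrite GTC not_cycle ?wnc // orbF; apply/negP => wz.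
  by rewrite (no_triangle vw wz) in vz.
have lv : leaf T v by rewrite -Cleaves.
have /eqP/mem_card1[u Tv] := lv; have vu : T v u by have := Tv u; rewrite !inE eqxx.
have unc : u \notin c by apply/negP => uc'; rewrite leaves_nonadjacent in vu.
have [[p [pc pv up]]|all_u] := pselect (exists p, [/\ p \in c, p != v & ~~ T u p]).
  exists u, p; split; [exact: TG|by apply: G_leaves3; rewrite // eq_sym|by apply: contraNneq unc => ->|].
  by rewrite GTC not_cycle ?unc // orbF.
(* If all other leaves hang from [u], then with [T] rooted at [v] a leaf below the inner neighbour
   [w] has parent [u]. So [w] is both an ancestor and a child of [u]. *)
have [w uw wnc] := inner_nbr u unc.
have [par [d [dr parr parP T_par]]] := rooted_tree v Ttree.
have wv : w != v by apply: contraTneq vc => <-.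
have uv : u != v by apply: contraTneq vc => <-.
have [x [lx xv wx]] := leaf_above dr parr parP T_par wv.
have xc : x \in c by rewrite Cleaves.
have ux : T u x by apply: contrapT => /negP nux; apply: all_u; exists x.
have par_nbr y : T u y -> y != v -> par y = u.
  move=> uy yv; case: (T_par _ _ uy) => [[_ puy]|[_ //]].
  case: (T_par _ _ vu) => [[]|[_ pu]]; first by rewrite eqxx.
  by rewrite -puy pu eqxx in yv.
have wx' : w != x by apply: contraNneq wnc => ->.
have [_] := below_step parr wx wx'; rewrite (par_nbr x ux xv) => wu.
have uw' : fconnect par w u by rewrite -(par_nbr w uw wv) fconnect1.
by have e := below_anti dr parr parP wu uw'; rewrite e adj_irr in uw.
Qed.

Lemma not_interval (R : realType) : ~ box_representable R G 1.
Proof.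
have [x [xc _]] : exists x, x \in c /\ idx x = 0 by apply: nth_leaf; exact: leq_trans kc.
move: (kc); rewrite leq_eqVlt => /orP[/eqP/esym k3|k4].
  apply: (@not_interval_graph R V G predT x) => // v _.
  by have [y [z [? ? ? ?]]] := no_simplicial_vertex v k3; exists y, z.
apply: (@not_interval_graph R V G (mem c) x) => // v vc.
exact: cycle_chords.
Qed.
End LowerBound.

Theorem theorem1 (R : realType) (V : finType) (G T : sgraph V) (c : seq V)
  (Gplanar : planar R G)
  (Ttree : is_tree T)
  (Ccycle : simple_cycle c)
  (Cleaves : forall x, (x \in c) = leaf T x)
  (GTC : forall x y, G x y = T x y || cycle_adj c x y)
  (GnotK4 : ~ isomorphic G (complete 'I_4)) :
  boxicity R G = 2%N.
Proof.
have [uc kc] := andP Ccycle.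
have [r [rc r0]] : exists r, r \in c /\ index r c = 0.
  by case: c kc {Ccycle Cleaves GTC uc} => // r s _; exists r; rewrite mem_head /= eqxx.
have [par [d [dr parr parP T_par]]] := rooted_tree r Ttree.
have upper := halin_box_representable Gplanar uc kc Cleaves GTC rc r0 dr parr parP T_par.
have lower := not_interval Ttree uc kc Cleaves GTC GnotK4 (R := R).
rewrite /boxicity; case: ex_minnP => -[//|[|n]] /= /asboolP rep_n min_n.
  by case: lower.
by have := min_n 2; rewrite /= ltnS ltnS => /(_ (asboolT upper)); case: n {rep_n min_n}.
Qed.
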